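(* Let $T:\mathbb{N}\to\mathbb{N}$ be any function with $T(n) = o(2^{n/3})$. Then, for a permutation oracle $A$ chosen uniformly at random, with probability $1$, $(\mathbf{NP}\cap\mathbf{co\text{-}NP})^A \not\subseteq \mathbf{BQTime}(T(n))^A$.
   Context: $\Sigma=\{0,1\}$. An oracle is a Boolean function $\Sigma^*\to\Sigma$; via a standard pairing function (the answer on the pair $(x,i)$ is the $i$-th bit of the function value) it is viewed as a length-preserving function $A:\Sigma^*\to\Sigma^*$. A permutation oracle is one for which this length-preserving function restricts to a permutation of $\Sigma^n$ for every $n\ge 0$; a uniformly random permutation oracle chooses, independently for each $n$, a uniformly random permutation of $\Sigma^n$. An oracle quantum Turing machine (QTM) is a well-formed quantum Turing machine (Bernstein–Vazirani model) with a query tape, a pre-query and a post-query state; on entering the pre-query state with query string $x\circ b$ ($x\in\Sigma^*$, $b\in\Sigma$) the query tape contents $|x\circ b\rangle$ become $|x\circ(b\oplus A(x))\rangle$ for the underlying Boolean oracle (acting linearly on superpositions), the machine passes to the post-query state, and nothing else changes. $\mathbf{BQTime}(T(n))^A$ is the set of languages $L$ such that some oracle QTM $M^A$ whose running time on every input of length $n$ is at most $T(n)$ accepts every $x\in L$ with probability at least $2/3$ and rejects every $x\notin L$ with probability at least $2/3$. $(\mathbf{NP}\cap\mathbf{co\text{-}NP})^A$ is the class of languages $L$ such that both $L$ and its complement are in $\mathbf{NP}^A$. *)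

(* Defs.v *)
From HB Require Import structures.
From mathcomp Require Import all_boot ssralg ssrint finmap.
From Stdlib Require Import Reals.

Unset Printing Implicit Defensive.

Definition cpx : Type := (R * R)%type.
Definition czero : cpx := (0%R, 0%R).
Definition cone : cpx := (1%R, 0%R).
Definition cadd (z w : cpx) : cpx := (z.1 + w.1, z.2 + w.2)%R.
Definition cmul (z w : cpx) : cpx :=
  (z.1 * w.1 - z.2 * w.2, z.1 * w.2 + z.2 * w.1)%R.
Definition cnorm2 (z : cpx) : R := (z.1 * z.1 + z.2 * z.2)%R.

Definition csum {T : Type} (s : seq T) (f : T -> cpx) : cpx :=
  foldr (fun a acc => cadd (f a) acc) czero s.
Definition rsum {T : Type} (s : seq T) (f : T -> R) : R :=
  foldr (fun a acc => (f a + acc)%R) 0%R s.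

Record alphabet := Alphabet {
  alph_sort :> finType;
  blank : alph_sort;
  bit : bool -> alph_sort;
  bit_inj : injective bit;
  bit_nblank : forall b, bit b != blank }.

Definition tape (G : alphabet) : Type := {fsfun int -> G with blank G}.

Definition empty_tape (G : alphabet) : tape G := [fsfun for fun _ : int => blank G].

Definition write_cell {G : alphabet} (t : tape G) (i : int) (g : G) : tape G :=
  [fsfun t with i |-> g].

Definition dir : Type := bool.
Definition move_head (h : int) (d : dir) : int :=
  if d then GRing.add h (Posz 1) else GRing.add h (Negz 0).

Fixpoint write_bits {G : alphabet} (t : tape G) (i : nat) (x : seq bool) : tape G :=
  if x is b :: x' then write_bits (write_cell t (Posz i) (bit G b)) i.+1 x' else t.

Definition input_tape (G : alphabet) (x : seq bool) : tape G :=
  write_bits (empty_tape G) 0 x.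

Definition decode_sym {G : alphabet} (g : G) : option bool :=
  if g == bit G true then Some true
  else if g == bit G false then Some false else None.

Fixpoint read_bits_from {G : alphabet} (t : tape G) (i : int) (fuel : nat) : seq bool :=
  if fuel is f.+1 then
    if decode_sym (t i) is Some b then b :: read_bits_from t (GRing.add i (Posz 1)) f
    else [::]
  else [::].

(* the bit string written on the tape: the maximal block of bit symbols
   starting at cell 0 (the fuel bound is never reached) *)
Definition tape_bits {G : alphabet} (t : tape G) : seq bool :=
  read_bits_from t (Posz 0) (size (finsupp t)).+1.

(* Configurations of a machine with a work tape and a query tape:
   (state, work tape, work head, query tape, query head). *)
Definition cfg (Q : finType) (G : alphabet) : Type :=
  (Q * tape G * int * tape G * int)%type.

Definition cfg_state {Q G} (c : cfg Q G) : Q := let: (q, _, _, _, _) := c in q.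
Definition cfg_work {Q G} (c : cfg Q G) : tape G := let: (_, t, _, _, _) := c in t.

Definition init_cfg {Q : finType} {G : alphabet} (q0 : Q) (x : seq bool) : cfg Q G :=
  (q0, input_tape G x, Posz 0, empty_tape G, Posz 0).

Definition apply_move {Q G} (c : cfg Q G) (r : Q * G * G * dir * dir) : cfg Q G :=
  let: (q, t1, h1, t2, h2) := c in
  let: (q', g1, g2, d1, d2) := r in
  (q', write_cell t1 h1 g1, move_head h1 d1, write_cell t2 h2 g2, move_head h2 d2).

Definition read_work {Q G} (c : cfg Q G) : G := let: (_, t1, h1, _, _) := c in t1 h1.
Definition read_query {Q G} (c : cfg Q G) : G := let: (_, _, _, t2, h2) := c in t2 h2.

(* Oracles.  A (length-preserving) oracle A : Σ* -> Σ* is turned into a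
   Boolean oracle via the pairing <y, i> = 1^i 0 y : the answer on <y,i> is
   the i-th bit (0-indexed) of A y (false if i >= |A y|, or if the query is
   not of the form 1^i 0 y). *)
Definition unpair (z : seq bool) : option (seq bool * nat) :=
  let i := find negb z in
  if i < size z then Some (drop i.+1 z, i) else None.

Definition bool_oracle (A : seq bool -> seq bool) (z : seq bool) : bool :=
  if unpair z is Some (y, i) then nth false (A y) i else false.

Definition perm_oracle (A : seq bool -> seq bool) : Prop :=
  (forall x, size (A x) = size x) /\
  (forall x y, size x = size y -> A x = A y -> x = y) /\
  (forall y, exists x, size x = size y /\ A x = y).

Record ntm := NTM {
  n_state : finType;
  n_alph : alphabet;
  n_delta : n_state -> n_alph -> n_alph -> seq (n_state * n_alph * n_alph * dir * dir);
  n_start : n_state;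
  n_acc : n_state;
  n_rej : n_state;
  n_query : n_state;
  n_yes : n_state;
  n_no : n_state }.

Definition ntm_cfg (M : ntm) : Type := cfg (n_state M) (n_alph M).

Definition ntm_step (M : ntm) (O : seq bool -> bool) (c : ntm_cfg M) : seq (ntm_cfg M) :=
  let: (q, t1, h1, t2, h2) := c in
  if (q == n_acc M) || (q == n_rej M) then [::]
  else if q == n_query M then
    [:: ((if O (tape_bits t2) then n_yes M else n_no M), t1, h1, t2, h2)]
  else map (apply_move c) (n_delta M q (t1 h1) (t2 h2)).

Definition ntm_reach (M : ntm) (O : seq bool -> bool) (x : seq bool) (k : nat)
  : seq (ntm_cfg M) :=
  iter k (fun s => flatten (map (ntm_step M O) s)) [:: init_cfg (n_start M) x].

Definition ntm_time_bounded (M : ntm) (O : seq bool -> bool) (x : seq bool) (t : nat) :=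
  ntm_reach M O x t.+1 = [::].

Definition ntm_accepts (M : ntm) (O : seq bool -> bool) (x : seq bool) :=
  exists k, has (fun c => cfg_state c == n_acc M) (ntm_reach M O x k).

Definition deterministic (M : ntm) :=
  forall q g1 g2, size (n_delta M q g1 g2) <= 1.

Definition NP_rel (A : seq bool -> seq bool) (L : seq bool -> Prop) : Prop :=
  exists (M : ntm) (d : nat), forall x : seq bool,
    ntm_time_bounded M (bool_oracle A) x (size x ^ d + d) /\
    (L x <-> ntm_accepts M (bool_oracle A) x).

Definition NP_coNP_rel (A : seq bool -> seq bool) (L : seq bool -> Prop) : Prop :=
  NP_rel A L /\ NP_rel A (fun x => ~ L x).

(* Polynomial-time computable reals (Bernstein--Vazirani's class of
   amplitudes): some deterministic TM, on input 1^n, halts in polynomial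
   time in the accepting state with a string  s w  on its work tape
   (s = sign bit, w = big-endian binary) such that the dyadic number
   (-1)^s w / 2^n is within 2^-n of the real. *)
Definition bin_val (w : seq bool) : nat := foldl (fun acc (b : bool) => acc.*2 + nat_of_bool b) 0 w.

Definition dyadic_of (w : seq bool) (n : nat) : R :=
  match w with
  | [::] => 0%R
  | s :: m => ((if s then (-1)%R else 1%R) * INR (bin_val m) / (2 ^ n))%R
  end.

Definition ptime_computable_real (r : R) : Prop :=
  exists (M : ntm) (d : nat), deterministic M /\
    forall n : nat,
      ntm_time_bounded M (fun _ => false) (nseq n true) (n ^ d + d) /\
      exists (k : nat) (c : ntm_cfg M),
        c \in ntm_reach M (fun _ => false) (nseq n true) k /\
        cfg_state c = n_acc M /\
        (Rabs (r - dyadic_of (tape_bits (cfg_work c)) n) <= / (2 ^ n))%R.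

Definition ptime_computable_cpx (z : cpx) : Prop :=
  ptime_computable_real z.1 /\ ptime_computable_real z.2.

(* Oracle quantum Turing machines (Bernstein--Vazirani model) with a work
   tape and a query tape.  q_delta q g1 g2 r is the amplitude of the
   transition r = (q', g1', g2', d1, d2) from state q reading g1, g2. *)
Record qtm := QTM {
  q_state : finType;
  q_alph : alphabet;
  q_delta : q_state -> q_alph -> q_alph -> (q_state * q_alph * q_alph * dir * dir) -> cpx;
  q_start : q_state;
  q_final : q_state;
  q_pre : q_state;
  q_post : q_state }.

Definition qtm_cfg (M : qtm) : Type := cfg (q_state M) (q_alph M).

Definition qmoves (M : qtm) : seq (q_state M * q_alph M * q_alph M * dir * dir) :=
  enum {: q_state M * q_alph M * q_alph M * dir * dir}.

(* the oracle step from the pre-query state: query tape x∘b becomes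
   x∘(b xor O(x)), the state becomes the post-query state, nothing else
   changes *)
Definition q_oracle_apply (M : qtm) (O : seq bool -> bool) (c : qtm_cfg M) : qtm_cfg M :=
  let: (q, t1, h1, t2, h2) := c in
  let s := tape_bits t2 in
  if s is [::] then (q_post M, t1, h1, t2, h2)
  else
    let k := (size s).-1 in
    (q_post M, t1, h1,
     write_cell t2 (Posz k) (bit (q_alph M) (last false s (+) O (take k s))), h2).

Definition q_succs (M : qtm) (O : seq bool -> bool) (c : qtm_cfg M) : seq (qtm_cfg M) :=
  if cfg_state c == q_pre M then [:: q_oracle_apply M O c]
  else map (apply_move c) (qmoves M).

Definition q_step_amp (M : qtm) (O : seq bool -> bool) (c c' : qtm_cfg M) : cpx :=
  if cfg_state c == q_pre M then (if c' == q_oracle_apply M O c then cone else czero)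
  else csum (qmoves M) (fun r =>
         if apply_move c r == c' then q_delta M (cfg_state c) (read_work c) (read_query c) r
         else czero).

(* a finitely supported superposition: a duplicate-free support list and an
   amplitude function (amplitudes off the list are ignored) *)
Definition superpos (M : qtm) : Type := (seq (qtm_cfg M) * (qtm_cfg M -> cpx))%type.

Definition evolve (M : qtm) (O : seq bool -> bool) (p : superpos M) : superpos M :=
  (undup (flatten (map (q_succs M O) p.1)),
   fun c' => csum p.1 (fun c => cmul (p.2 c) (q_step_amp M O c c'))).

Definition sp_norm2 (M : qtm) (p : superpos M) : R := rsum p.1 (fun c => cnorm2 (p.2 c)).

Definition well_formed (M : qtm) : Prop :=
  forall (O : seq bool -> bool) (p : superpos M),
    uniq p.1 -> sp_norm2 M (evolve M O p) = sp_norm2 M p.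

Definition amplitudes_ptime (M : qtm) : Prop :=
  forall q g1 g2 r, ptime_computable_cpx (q_delta M q g1 g2 r).

Definition q_run (M : qtm) (O : seq bool -> bool) (x : seq bool) (t : nat) : superpos M :=
  iter t (evolve M O)
    ([:: init_cfg (q_start M) x],
     fun c => if c == init_cfg (q_start M) x then cone else czero).

Definition q_halts_at (M : qtm) (O : seq bool -> bool) (x : seq bool) (t : nat) : Prop :=
  (forall c, c \in (q_run M O x t).1 -> (q_run M O x t).2 c <> czero ->
     cfg_state c = q_final M) /\
  (forall t', t' < t -> forall c, c \in (q_run M O x t').1 ->
     (q_run M O x t').2 c <> czero -> cfg_state c <> q_final M).

Definition acc_prob (M : qtm) (O : seq bool -> bool) (x : seq bool) (t : nat) : R :=
  rsum (q_run M O x t).1 (fun c =>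
    if cfg_work c (Posz 0) == bit (q_alph M) true then cnorm2 ((q_run M O x t).2 c) else 0%R).

Definition rej_prob (M : qtm) (O : seq bool -> bool) (x : seq bool) (t : nat) : R :=
  rsum (q_run M O x t).1 (fun c =>
    if cfg_work c (Posz 0) == bit (q_alph M) true then 0%R else cnorm2 ((q_run M O x t).2 c)).

Definition BQTime_rel (T : nat -> nat) (A : seq bool -> seq bool) (L : seq bool -> Prop) : Prop :=
  exists M : qtm, well_formed M /\ amplitudes_ptime M /\
    forall x : seq bool, exists t : nat,
      t <= T (size x) /\ q_halts_at M (bool_oracle A) x t /\
      (L x -> (2 / 3 <= acc_prob M (bool_oracle A) x t)%R) /\
      (~ L x -> (2 / 3 <= rej_prob M (bool_oracle A) x t)%R).

(* Uniformly random permutation oracle.  Basic cylinder sets fix the oracle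
   on all strings of length < k; such a cylinder (of a permutation oracle B)
   has probability prod_{n<k} 1/(2^n)!.  A set of permutation oracles is
   null iff for every eps > 0 it is covered by countably many cylinders of
   total probability <= eps (null sets of the product measure). *)
Definition cyl_weight (k : nat) : R :=
  foldr (fun n acc => (/ INR ((2 ^ n)`!) * acc)%R) 1%R (iota 0 k).

Definition cylinder (B : seq bool -> seq bool) (k : nat) (A : seq bool -> seq bool) : Prop :=
  forall x, size x < k -> A x = B x.

Definition perm_null (N : (seq bool -> seq bool) -> Prop) : Prop :=
  forall eps : R, (0 < eps)%R ->
    exists (B : nat -> seq bool -> seq bool) (K : nat -> nat),
      (forall j, perm_oracle (B j)) /\
      (forall A, perm_oracle A -> N A -> exists j, cylinder (B j) (K j) A) /\
      (forall J, (rsum (iota 0 J) (fun j => cyl_weight (K j)) <= eps)%R).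

Definition almost_surely_perm (P : (seq bool -> seq bool) -> Prop) : Prop :=
  perm_null (fun A => ~ P A).

Definition little_o_2pow_third (T : nat -> nat) : Prop :=
  forall eps : R, (0 < eps)%R ->
    exists N : nat, forall n : nat, N <= n ->
      (INR (T n) <= eps * Rpower 2 (INR n / 3))%R.

(* Main.v *)
(** The language is L_A = { y : the preimage of 1^|y| under A starts with 1 }; a
witness is the preimage itself, so L_A is in NP and, A being a permutation, in co-NP.

For the lower bound fix the oracle outside length n and compare a permutation p with
p' = p o (x z), where p x = 1^n and x, z differ in their first bit, so p' z = 1^n and
the answers for p and p' differ.  The overlap of the two runs starts at 1 and must fall
to 17/18 or below if both are correct (it is 0 if they halt at different times).  One
step lowers it by at most
  s m_p(x) + w m_p'(x) + w m_p(z) + s m_p'(z),   s w = 1,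
where m_p(x) is the query mass on x.  The involution (p, z) |-> (p', x) exchanges the
two runs; m_p(x) <= 1 and sum_z m_p(z) <= 1, so the average total loss over all pairs
after T steps is at most 2 T (s + w / 2^n).  With s = 1 / (288 (T + 1)) this is too
small when T^2 = o(2^n), and at least a quarter of the permutations are decided wrongly.

A run of t steps only queries strings of length at most t, hence at widely spaced
lengths these failures give a factor 3/4 each, and the oracles on which a given machine
decides L_A are covered by cylinders of arbitrarily small total weight.  Finally, up to
isomorphism there are only countably many machines with polynomial-time computable
amplitudes. *)

From Stdlib Require Lra.
From Stdlib Require Import Reals.
Require Import Defs.
From HB Require Import structures.
From mathcomp Require Import all_boot all_order all_algebra all_fingroup finmap.
From mathcomp Require Import boolp Rstruct.
From mathcomp Require Import ring lra zify.

Set Implicit Arguments.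
Unset Strict Implicit.
Unset Printing Implicit Defensive.

Import Order.TTheory GRing.Theory Num.Theory.
Local Open Scope ring_scope.
(* Otherwise arguments of type [R] would be parsed with Stdlib's [Rmult] and friends. *)
Bind Scope ring_scope with R.

(** * Inner products and single steps *)

Lemma rsumE (T : Type) (s : seq T) (f : T -> R) : rsum s f = \sum_(a <- s) f a.
Proof. by elim: s => [|a s IHs] /=; rewrite ?big_nil ?big_cons ?IHs. Qed.

Lemma csum1 (T : Type) (s : seq T) (f : T -> cpx) :
  (csum s f).1 = \sum_(a <- s) (f a).1.
Proof. by elim: s => [|a s IHs] /=; rewrite ?big_nil ?big_cons -?IHs. Qed.

Lemma csum2 (T : Type) (s : seq T) (f : T -> cpx) :
  (csum s f).2 = \sum_(a <- s) (f a).2.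
Proof. by elim: s => [|a s IHs] /=; rewrite ?big_nil ?big_cons -?IHs. Qed.

Lemma cpx_eq (z w : cpx) : z.1 = w.1 -> z.2 = w.2 -> z = w.
Proof. by case: z w => [a b] [c d] /= -> ->. Qed.

Lemma eq_csum (T : eqType) (s : seq T) (f g : T -> cpx) :
  {in s, f =1 g} -> csum s f = csum s g.
Proof.
by move=> eqfg; apply: cpx_eq; rewrite ?csum1 ?csum2; apply: eq_big_seq => a /eqfg ->.
Qed.

Lemma sum_subset (T : eqType) (s s' : seq T) (f : T -> R) :
  uniq s -> uniq s' -> {subset s <= s'} -> (forall a, a \notin s -> f a = 0) ->
  \sum_(a <- s') f a = \sum_(a <- s) f a.
Proof.
move=> us us' sub f0; have pe : perm_eq s [seq a <- s' | a \in s].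
  apply: uniq_perm => //; first exact: filter_uniq.
  by move=> a; rewrite mem_filter; case: (boolP (a \in s)) => // /sub ->.
rewrite (perm_big _ pe) big_filter [RHS]big_mkcond; apply: eq_bigr => a _.
by case: ifPn => // /f0.
Qed.

(** The real part of the Hermitian inner product; it gives the same squared norms and is enough to
    compare two runs. *)
Definition cdot (z w : cpx) : R := z.1 * w.1 + z.2 * w.2.

Lemma cdot_ge0 z : 0 <= cdot z z.
Proof. by rewrite /cdot addr_ge0 // -expr2 sqr_ge0. Qed.

(** Cauchy-Schwarz with free weights in place of square roots, from [0 <= s * (x - w * y) ^+ 2] in
    each coordinate. The weights stay open until the losses are averaged. *)
Lemma cdot_le s w a b : 0 < s -> s * w = 1 -> cdot a b <= (s * cdot a a + w * cdot b b) / 2.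
Proof.
move=> s0 sw1; rewrite /cdot.
have h x y : x * y <= (s * (x * x) + w * (y * y)) / 2.
  have : 0 <= s * (x - w * y) ^+ 2 by rewrite mulr_ge0 ?sqr_ge0 // ltW.
  have -> : s * (x - w * y) ^+ 2 = s * (x * x) - (s * w) *+ 2 * (x * y)
      + (s * w) * (w * (y * y)) by ring.
  by rewrite sw1; lra.
by have := h a.1 b.1; have := h a.2 b.2; lra.
Qed.

Section QuantumStep.
Variable M : qtm.
Hypothesis wfM : well_formed M.

Local Notation vec := (qtm_cfg M -> cpx).

Implicit Types (S : seq (qtm_cfg M)) (f g : vec) (O : seq bool -> bool).

Definition ip S f g : R := \sum_(c <- S) cdot (f c) (g c).

Definition supported S f := forall c, c \notin S -> f c = czero.

Definition vadd f g : vec := fun c => cadd (f c) (g c).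

Definition vneg f : vec := fun c => (- (f c).1, - (f c).2).

Definition restr (P : pred (qtm_cfg M)) f : vec := fun c => if P c then f c else czero.

Definition succs O S := undup (flatten (map (q_succs M O) S)).

(** The amplitude part of [evolve] over an arbitrary list [S], so that two runs with different
    supports can be stepped over one common list. *)
Definition ustep O S f : vec := fun c' => csum S (fun c => cmul (f c) (q_step_amp M O c c')).

Lemma ip_ge0 S f : 0 <= ip S f f.
Proof. by apply: sumr_ge0 => c _; apply: cdot_ge0. Qed.

Lemma ipC S f g : ip S f g = ip S g f.
Proof. by apply: eq_bigr => c _; rewrite /cdot; ring. Qed.

Lemma ipDl S f g h : ip S (vadd f g) h = ip S f h + ip S g h.
Proof. by rewrite /ip -big_split; apply: eq_bigr => c _; rewrite /cdot /vadd /cadd /= !RplusE; ring. Qed.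

Lemma ipDr S f g h : ip S f (vadd g h) = ip S f g + ip S f h.
Proof. by rewrite ![ip S f _]ipC ipDl. Qed.

Lemma ipNr S f g : ip S f (vneg g) = - ip S f g.
Proof. by rewrite /ip -sumrN; apply: eq_bigr => c _; rewrite /cdot /vneg /=; ring. Qed.

Lemma ipNN S f : ip S (vneg f) (vneg f) = ip S f f.
Proof. by apply: eq_bigr => c _; rewrite /cdot /vneg /=; ring. Qed.

Lemma ip_le S s w f g : 0 < s -> s * w = 1 -> ip S f g <= (s * ip S f f + w * ip S g g) / 2.
Proof.
move=> s0 sw1; rewrite /ip !mulr_sumr -big_split mulr_suml.
by apply: ler_sum => c _; apply: cdot_le.
Qed.

Lemma ip_ge S s w f g : 0 < s -> s * w = 1 -> - ((s * ip S f f + w * ip S g g) / 2) <= ip S f g.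
Proof. by move=> s0 sw1; rewrite lerNl -ipNr -(ipNN S g); apply: ip_le. Qed.

Lemma ip_subset S S' f g :
  uniq S -> uniq S' -> {subset S <= S'} -> supported S f -> ip S' f g = ip S f g.
Proof.
move=> uS uS' sub f0; apply: sum_subset => // c /f0 ->.
by rewrite /cdot /= !mul0r addr0.
Qed.

Lemma supported_restr S P f : supported S f -> supported S (restr P f).
Proof. by move=> f0 c /f0; rewrite /restr => ->; rewrite if_same. Qed.

Lemma restr_split P f : f = vadd (restr P f) (restr (predC P) f).
Proof.
apply: funext => c; rewrite /vadd /restr /=.
by case: (P c); apply: cpx_eq; rewrite /= ?Rplus_0_r ?Rplus_0_l.
Qed.

Lemma q_step_amp0 O c c' : c' \notin q_succs M O c -> q_step_amp M O c c' = czero.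
Proof.
rewrite /q_succs /q_step_amp; case: ifP => _; first by rewrite inE => /negPf ->.
move=> nc'; transitivity (csum (qmoves M) (fun=> czero)).
  apply: eq_csum => r rin; case: eqP => // eqc.
  by rewrite -eqc map_f in nc'.
by elim: (qmoves M) => //= r s ->; apply: cpx_eq; rewrite /= Rplus_0_r.
Qed.

Lemma supported_ustep O S f : supported (succs O S) (ustep O S f).
Proof.
move=> c' nc'; rewrite /ustep; have e : {in S, (fun c => cmul (f c) (q_step_amp M O c c')) =1 fun=> czero}.
  move=> c cS; rewrite q_step_amp0; last first.
    apply: contra nc' => c'in; rewrite mem_undup; apply/flattenP.
    by exists (q_succs M O c) => //; apply: map_f.
  by apply: cpx_eq; rewrite /= !Rmult_0_r ?Rminus_0_r ?Rplus_0_r.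
by rewrite (eq_csum e); elim: (S) => //= c s ->; apply: cpx_eq; rewrite /= Rplus_0_r.
Qed.

Lemma ustep_subset O S S' f :
  uniq S -> uniq S' -> {subset S <= S'} -> supported S f -> ustep O S' f = ustep O S f.
Proof.
move=> uS uS' sub f0; apply: funext => c'.
by apply: cpx_eq; rewrite ?csum1 ?csum2; apply: sum_subset => // c /f0 -> /=;
  rewrite !Rmult_0_l ?Rminus_0_r ?Rplus_0_r.
Qed.

Lemma ustepD O S f g : ustep O S (vadd f g) = vadd (ustep O S f) (ustep O S g).
Proof.
apply: funext => c'; apply: cpx_eq; rewrite /ustep /vadd /= ?csum1 ?csum2 -[Rplus _ _]big_split;
  by apply: eq_bigr => c _ /=; rewrite ?RplusE ?RminusE ?RmultE; ring.
Qed.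

Lemma eq_ustep O O' S f :
  (forall c, f c != czero -> q_step_amp M O c =1 q_step_amp M O' c) ->
  ustep O S f = ustep O' S f.
Proof.
move=> eqO; apply: funext => c'; apply: eq_csum => c _.
case: (eqVneq (f c) czero) => [->|/eqO -> //].
by apply: cpx_eq; rewrite /= !Rmult_0_l.
Qed.

(** [well_formed] gives this over the exact list of successors; a larger list adds only zeros. *)
Lemma ustep_norm O S S2 f :
  uniq S -> uniq S2 -> {subset succs O S <= S2} ->
  ip S2 (ustep O S f) (ustep O S f) = ip S f f.
Proof.
move=> uS uS2 sub; rewrite (@ip_subset (succs O S)) ?undup_uniq //; last exact: supported_ustep.
by have := wfM O (p := (S, f)) uS; rewrite /sp_norm2 !rsumE.
Qed.

(** Polarisation: norm preservation is applied to [f], [g] and their sum. *)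
Lemma ustep_ip O S S2 f g :
  uniq S -> uniq S2 -> {subset succs O S <= S2} ->
  ip S2 (ustep O S f) (ustep O S g) = ip S f g.
Proof.
move=> uS uS2 sub; have := ustep_norm (vadd f g) uS uS2 sub.
rewrite ustepD !ipDl !ipDr !(ustep_norm _ uS uS2 sub).
rewrite [ip S2 (ustep O S g) _]ipC [ip S g f]ipC; lra.
Qed.

(* The class of a configuration about to query <y, i> is [y]: its step depends on the
   oracle function only through the value at [y]. *)
Definition query_string (c : qtm_cfg M) : option (seq bool) :=
  let: (q, _, _, t2, _) := c in
  let s := tape_bits t2 in
  if q == q_pre M then
    if s is [::] then None else omap fst (unpair (take (size s).-1 s))
  else None.

Lemma q_step_amp_agree A A' c :
  (forall y, query_string c = Some y -> A y = A' y) ->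
  q_step_amp M (bool_oracle A) c =1 q_step_amp M (bool_oracle A') c.
Proof.
case: c => [[[[q t1] h1] t2] h2] /=; rewrite /q_step_amp /q_oracle_apply /= => agree c'.
case: ifP agree => _; last by move=> _; reflexivity.
case: (tape_bits t2) => [|b s]; first by move=> _; reflexivity.
rewrite /bool_oracle; case: (unpair _) => [[y i]|] /=; last by move=> _; reflexivity.
by move=> /(_ y erefl) ->; reflexivity.
Qed.

Definition mass S f y : R := let h := restr (fun c => query_string c == Some y) f in ip S h h.

Lemma massE S f y :
  mass S f y = \sum_(c <- S) (if query_string c == Some y then cdot (f c) (f c) else 0).
Proof.
rewrite /mass /ip; apply: eq_bigr => c _; rewrite /restr.
by case: ifP => // _; rewrite /cdot /= mul0r addr0.
Qed.

Lemma mass_ge0 S f y : 0 <= mass S f y. Proof. exact: ip_ge0. Qed.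

(** A configuration lies in at most one query class, so its weight is counted at most once. *)
Lemma sum_mass_le S f (ys : seq (seq bool)) :
  uniq ys -> \sum_(y <- ys) mass S f y <= ip S f f.
Proof.
move=> uys; under eq_bigr do rewrite massE.
rewrite exchange_big /=; apply: ler_sum => c _.
case E: (query_string c) => [y|]; last by rewrite big1 // cdot_ge0.
case: (boolP (y \in ys)) => yin.
  rewrite (bigD1_seq y) //= eqxx big1 ?addr0 // => z zy.
  by case: eqP => // -[yz]; rewrite yz eqxx in zy.
rewrite big1_seq ?cdot_ge0 // => z /andP[_ zin].
by case: eqP => // -[yz]; rewrite yz zin in yin.
Qed.

(* The two oracles only disagree on the query classes of [x] and [z]; a mixed
   class pair contributes nothing new, because some single oracle acts like [A] on
   the one class and like [A'] on the other. *)
Lemma ustep_ip_swap (A A' : seq bool -> seq bool) x z S S2 f g s w :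
  x != z -> (forall y, y != x -> y != z -> A y = A' y) ->
  uniq S -> uniq S2 ->
  {subset succs (bool_oracle A) S <= S2} -> {subset succs (bool_oracle A') S <= S2} ->
  0 < s -> 0 < w -> s * w = 1 ->
  ip S f g - ip S2 (ustep (bool_oracle A) S f) (ustep (bool_oracle A') S g)
   <= s * mass S f x + w * mass S g x + (w * mass S f z + s * mass S g z).
Proof.
move=> xz agree uS uS2 sub sub' s0 w0 sw1.
set Px := fun c : qtm_cfg M => query_string c == Some x.
set Pz := fun c : qtm_cfg M => query_string c == Some z.
set fr := restr (predC Pz) (restr (predC Px) f).
set gr := restr (predC Pz) (restr (predC Px) g).
(* The two query classes are disjoint because [x != z]. *)
have split3 h : h = vadd (restr Px h) (vadd (restr Pz h) (restr (predC Pz) (restr (predC Px) h))).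
  rewrite {1}(restr_split Px h); congr vadd; rewrite {1}(restr_split Pz (restr _ h)); congr vadd.
  apply: funext => c; rewrite /restr /= /Pz; case: eqP => // Ec.
  rewrite /Px Ec; case: eqP => //= -[zx]; by rewrite zx eqxx in xz.
pose B h k := ip S2 (ustep (bool_oracle A) S h) (ustep (bool_oracle A') S k).
(* If one oracle [C] acts like [A] on the left vector and like [A'] on the right one, both steps are
   steps of [C] and keep the inner product. *)
have mix (C : seq bool -> seq bool) (P Q : pred (qtm_cfg M)) h k :
    (forall c, P c -> forall y, query_string c = Some y -> A y = C y) ->
    (forall c, Q c -> forall y, query_string c = Some y -> A' y = C y) ->
    (forall c, h c != czero -> P c) -> (forall c, k c != czero -> Q c) ->
    B h k = ip S h k.
  move=> AC A'C hP kQ; rewrite /B.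
  have eh : ustep (bool_oracle A) S h = ustep (bool_oracle C) S h.
    by apply: eq_ustep => c /hP Pc; apply: q_step_amp_agree; apply: AC.
  have ek : ustep (bool_oracle A') S k = ustep (bool_oracle C) S k.
    by apply: eq_ustep => c /kQ Qc; apply: q_step_amp_agree; apply: A'C.
  (* [S2] need not contain the successors under the hybrid oracle [C], so the sum is moved to a
     larger list. *)
  pose S3 := undup (S2 ++ succs (bool_oracle C) S).
  have uS3 : uniq S3 by exact: undup_uniq.
  rewrite -(@ip_subset S2 S3) //; last first.
  - by move=> c nc; apply: supported_ustep; apply: contra nc; apply: sub.
  - by move=> c cin; rewrite /S3 mem_undup mem_cat cin.
  by rewrite eh ek ustep_ip // => c cin; rewrite /S3 mem_undup mem_cat cin orbT.
have nz (P : pred (qtm_cfg M)) h c : restr P h c != czero -> P c by rewrite /restr; case: (P c); rewrite ?eqxx.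
have nr h c : restr (predC Pz) (restr (predC Px) h) c != czero -> ~~ Px c && ~~ Pz c.
  by rewrite /restr /=; case: (Pz c); case: (Px c); rewrite ?eqxx.
have Arest c : ~~ Px c && ~~ Pz c -> forall y, query_string c = Some y -> A y = A' y.
  move=> /andP[ncx ncz] y Ey; apply: agree.
    by apply: contra ncx => /eqP yx; rewrite /Px Ey yx.
  by apply: contra ncz => /eqP yz; rewrite /Pz Ey yz.
(* Of the nine terms of the expansion only the two diagonal ones, [x] with [x] and [z] with [z], can
   change. *)
have BD : ip S f g - B f g = (ip S (restr Px f) (restr Px g) - B (restr Px f) (restr Px g))
     + (ip S (restr Pz f) (restr Pz g) - B (restr Pz f) (restr Pz g)).
  have Bxz : B (restr Px f) (restr Pz g) = ip S (restr Px f) (restr Pz g).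
    apply: (mix (fun y => if y == x then A x else A' y) Px Pz) => [c|c||]; try exact: nz.
      by move=> /eqP Ec y; rewrite Ec => -[<-]; rewrite eqxx.
    by move=> /eqP Ec y; rewrite Ec => -[<-]; rewrite eq_sym (negPf xz).
  have Bzx : B (restr Pz f) (restr Px g) = ip S (restr Pz f) (restr Px g).
    apply: (mix (fun y => if y == z then A z else A' y) Pz Px) => [c|c||]; try exact: nz.
      by move=> /eqP Ec y; rewrite Ec => -[<-]; rewrite eqxx.
    by move=> /eqP Ec y; rewrite Ec => -[<-]; rewrite (negPf xz).
  have Bhr h : B h gr = ip S h gr.
    apply: (mix A predT (fun c => ~~ Px c && ~~ Pz c)) => //; last exact: nr.
    by move=> c /Arest eA y /eA.
  have Brk k : B fr k = ip S fr k.
    apply: (mix A' (fun c => ~~ Px c && ~~ Pz c) predT) => //; exact: nr.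
  have e1 : B f g = B (vadd (restr Px f) (vadd (restr Pz f) fr))
      (vadd (restr Px g) (vadd (restr Pz g) gr)) by rewrite -!split3.
  have e2 : ip S f g = ip S (vadd (restr Px f) (vadd (restr Pz f) fr))
      (vadd (restr Px g) (vadd (restr Pz g) gr)) by rewrite -!split3.
  rewrite e1 e2 /B !ustepD !ipDl !ipDr -!/(B _ _) Bxz Bzx !Bhr !Brk; ring.
(* The inner products before and after the step each cost half of the right-hand side, since the
   step keeps both norms. *)
have bound (P : pred (qtm_cfg M)) s' w' : 0 < s' -> s' * w' = 1 ->
    ip S (restr P f) (restr P g) - B (restr P f) (restr P g)
    <= s' * ip S (restr P f) (restr P f) + w' * ip S (restr P g) (restr P g).
  move=> s0' sw1'; have := ip_le S (restr P f) (restr P g) s0' sw1'.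
  have := ip_ge S2 (ustep (bool_oracle A) S (restr P f))
    (ustep (bool_oracle A') S (restr P g)) s0' sw1'.
  rewrite (ustep_norm _ uS uS2 sub) (ustep_norm _ uS uS2 sub') /B; lra.
have ws1 : w * s = 1 by rewrite mulrC.
(* The weights are exchanged for [z], so that the four terms pair up under the later involution
   [swap_pair]. *)
rewrite -/(B f g) BD /mass -/Px -/Pz; have := bound Px s w s0 sw1; have := bound Pz w s w0 ws1; lra.
Qed.

End QuantumStep.

(** * Overlap of two runs *)

Lemma two_thirdsE : (Rdiv (IZR 2) (IZR 3)) = 2 / 3 :> R.
Proof.
have -> : IZR 2 = INR 2 by rewrite INR_IZR_INZ.
have -> : IZR 3 = INR 3 by rewrite INR_IZR_INZ.
by rewrite RdivE !INRE.
Qed.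

Section Runs.
Variable M : qtm.
Hypothesis wfM : well_formed M.

(** Amplitudes off the support list of a [superpos] are meaningless, so they are replaced by
    zero. *)
Definition psi O y u : qtm_cfg M -> cpx :=
  fun c => if c \in (q_run M O y u).1 then (q_run M O y u).2 c else czero.

Lemma q_run_uniq O y u : uniq (q_run M O y u).1.
Proof. by case: u => [|u]; rewrite // /q_run iterS undup_uniq. Qed.

Lemma supported_psi O y u : supported (q_run M O y u).1 (psi O y u).
Proof. by move=> c /negPf nc; rewrite /psi nc. Qed.

Lemma q_runS O y u : (q_run M O y u.+1).1 = succs O (q_run M O y u).1.
Proof. by []. Qed.

Lemma ustep_psi O y u (S : seq (qtm_cfg M)) :
  uniq S -> {subset (q_run M O y u).1 <= S} ->
  ustep O S (psi O y u) = psi O y u.+1.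
Proof.
move=> uS sub; rewrite (ustep_subset O (q_run_uniq O y u) uS sub (@supported_psi O y u)).
have e : ustep O (q_run M O y u).1 (psi O y u) = ustep O (q_run M O y u).1 (q_run M O y u).2.
  by apply: funext => c'; apply: eq_csum => c cin; rewrite /psi cin.
apply: funext => c; rewrite {2}/psi; case: ifPn => [_|nc]; first by rewrite e.
by apply: supported_ustep; rewrite -q_runS.
Qed.

Lemma psi_norm O y u : ip (q_run M O y u).1 (psi O y u) (psi O y u) = 1.
Proof.
elim: u => [|u IHu].
  rewrite /ip /q_run /= big_seq1 /psi /q_run /= inE eqxx /= /cdot /=.
  by rewrite mulr1 mulr0 addr0.
rewrite -(ustep_psi (q_run_uniq O y u)) // q_runS ustep_norm ?IHu ?q_run_uniq ?undup_uniq //.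
Qed.

Definition pair_support O O' y u := undup ((q_run M O y u).1 ++ (q_run M O' y u).1).

Definition overlap O O' y u := ip (pair_support O O' y u) (psi O y u) (psi O' y u).

Definition query_mass O y u x := mass (q_run M O y u).1 (psi O y u) x.

Lemma query_mass_ge0 O y u x : 0 <= query_mass O y u x.
Proof. exact: mass_ge0. Qed.

Lemma sum_query_mass_le O y u (xs : seq (seq bool)) :
  uniq xs -> \sum_(x <- xs) query_mass O y u x <= 1.
Proof. by move=> uxs; rewrite -(psi_norm O y u); apply: sum_mass_le. Qed.

Lemma pair_supportl O O' y u : {subset (q_run M O y u).1 <= pair_support O O' y u}.
Proof. by move=> c cin; rewrite /pair_support mem_undup mem_cat cin. Qed.

Lemma pair_supportr O O' y u : {subset (q_run M O' y u).1 <= pair_support O O' y u}.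
Proof. by move=> c cin; rewrite /pair_support mem_undup mem_cat cin orbT. Qed.

Lemma mass_subset O y u x (S : seq (qtm_cfg M)) : uniq S -> {subset (q_run M O y u).1 <= S} ->
  mass S (psi O y u) x = query_mass O y u x.
Proof.
move=> uS sub; rewrite /mass /query_mass /mass.
apply: (ip_subset _ (q_run_uniq _ _ _) uS sub); apply: supported_restr; exact: supported_psi.
Qed.

Definition swap_cost (O O' : seq bool -> bool) y u x z (s w : R) :=
  s * query_mass O y u x + w * query_mass O' y u x +
  (w * query_mass O y u z + s * query_mass O' y u z).

(** Both runs start in the same configuration, with overlap 1, and [ustep_ip_swap] bounds the loss
    in each step. *)
Lemma overlap_swap (A A' : seq bool -> seq bool) y x z s w t :
  x != z -> (forall y, y != x -> y != z -> A y = A' y) ->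
  0 < s -> 0 < w -> s * w = 1 ->
  1 - overlap (bool_oracle A) (bool_oracle A') y t
   <= \sum_(u < t) swap_cost (bool_oracle A) (bool_oracle A') y u x z s w.
Proof.
move=> xz agree s0 w0 sw1; set O := bool_oracle A; set O' := bool_oracle A'.
elim: t => [|t IHt].
  rewrite big_ord0 /overlap -(psi_norm O y 0).
  have -> : psi O' y 0 = psi O y 0 by [].
  rewrite (ip_subset _ (q_run_uniq O y 0)) ?subrr ?undup_uniq //.
    exact: pair_supportl.
  exact: supported_psi.
rewrite big_ord_recr /=.
have uS : uniq (pair_support O O' y t) by exact: undup_uniq.
pose S2 := undup (succs O (pair_support O O' y t) ++ succs O' (pair_support O O' y t)).
have uS2 : uniq S2 by exact: undup_uniq.
have sub1 : {subset succs O (pair_support O O' y t) <= S2}.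
  by move=> c cin; rewrite /S2 mem_undup mem_cat cin.
have sub2 : {subset succs O' (pair_support O O' y t) <= S2}.
  by move=> c cin; rewrite /S2 mem_undup mem_cat cin orbT.
have := ustep_ip_swap wfM (psi O y t) (psi O' y t) xz agree uS uS2 sub1 sub2 s0 w0 sw1.
have subl := @pair_supportl O O' y t; have subr := @pair_supportr O O' y t.
rewrite !(mass_subset _ uS subl) !(mass_subset _ uS subr).
rewrite (ustep_psi uS subl) (ustep_psi uS subr).
rewrite -/(overlap O O' y t) -/(swap_cost O O' y t x z s w).
have -> : ip S2 (psi O y t.+1) (psi O' y t.+1) = overlap O O' y t.+1.
  (* Neither [S2] nor the pair support need contain the other; both sums are compared through a
     common larger list. *)
  pose S3 := undup (S2 ++ pair_support O O' y t.+1).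
  have uS3 : uniq S3 by exact: undup_uniq.
  have sub3 : {subset S2 <= S3} by move=> c cin; rewrite /S3 mem_undup mem_cat cin.
  have sub4 : {subset pair_support O O' y t.+1 <= S3}.
    by move=> c cin; rewrite /S3 mem_undup mem_cat cin orbT.
  have supp2 : supported S2 (psi O y t.+1).
    move=> c nc; rewrite -(ustep_psi uS subl); apply: supported_ustep.
    by apply: contra nc; apply: sub1.
  have supp4 : supported (pair_support O O' y t.+1) (psi O y t.+1).
    by move=> c nc; apply: supported_psi; apply: contra nc; apply: pair_supportl.
  by rewrite -(ip_subset _ uS2 uS3 sub3 supp2) (ip_subset _ _ uS3 sub4 supp4) ?undup_uniq.
by move: IHt; rewrite -/O -/O'; lra.
Qed.

(** The clause of [BQTime_rel] for a single input, with the time bound and the membership statement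
    as parameters. *)
Definition decides (A : seq bool -> seq bool) y tm (b : Prop) : Prop :=
  exists t : nat, (t <= tm)%N /\ q_halts_at M (bool_oracle A) y t /\
    (b -> Rle (Rdiv (IZR 2) (IZR 3)) (acc_prob M (bool_oracle A) y t)) /\
    (~ b -> Rle (Rdiv (IZR 2) (IZR 3)) (rej_prob M (bool_oracle A) y t)).

Definition accepting (c : qtm_cfg M) := cfg_work c (Posz 0) == bit (q_alph M) true.

Lemma psi_halted O y t c : q_halts_at M O y t -> psi O y t c != czero -> cfg_state c = q_final M.
Proof.
move=> [fin _]; rewrite /psi; case: ifP; last by rewrite eqxx.
by move=> cin /eqP; apply: fin.
Qed.

Lemma psi_running O y t t' c : q_halts_at M O y t -> (t' < t)%N ->
  psi O y t' c != czero -> cfg_state c <> q_final M.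
Proof.
move=> [_ run] tt'; rewrite /psi; case: ifP; last by rewrite eqxx.
by move=> cin /eqP; apply: run.
Qed.

Lemma overlapC O O' y u : overlap O O' y u = overlap O' O y u.
Proof.
rewrite /overlap ipC /ip; apply: perm_big; apply: uniq_perm; rewrite ?undup_uniq //.
by move=> c; rewrite !mem_undup !mem_cat orbC.
Qed.

(** At time [t] the first run lives in the final state only, while the second has no amplitude there
    yet. *)
Lemma overlap_halt_lt O O' y t t' : q_halts_at M O y t -> q_halts_at M O' y t' ->
  (t < t')%N -> overlap O O' y t = 0.
Proof.
move=> h h' tt'; apply: big1 => c _.
case: (eqVneq (psi O y t c) czero) => [->|n]; first by rewrite /cdot !mul0r addr0.
case: (eqVneq (psi O' y t c) czero) => [->|n']; first by rewrite /cdot !mulr0 addr0.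
by case: (psi_running h' tt' n'); apply: psi_halted h n.
Qed.

Lemma acc_probE O y t (S : seq (qtm_cfg M)) :
  uniq S -> {subset (q_run M O y t).1 <= S} ->
  acc_prob M O y t = \sum_(c <- S) (if accepting c then cdot (psi O y t c) (psi O y t c) else 0).
Proof.
move=> uS sub; rewrite /acc_prob rsumE.
rewrite [RHS](@sum_subset _ (q_run M O y t).1) ?q_run_uniq //; last first.
  by move=> c /supported_psi ->; rewrite /cdot /= mul0r addr0 if_same.
by apply: eq_big_seq => c cin; rewrite /psi cin.
Qed.

Lemma rej_probE O y t (S : seq (qtm_cfg M)) :
  uniq S -> {subset (q_run M O y t).1 <= S} ->
  rej_prob M O y t = \sum_(c <- S) (if accepting c then 0 else cdot (psi O y t c) (psi O y t c)).
Proof.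
move=> uS sub; rewrite /rej_prob rsumE.
rewrite [RHS](@sum_subset _ (q_run M O y t).1) ?q_run_uniq //; last first.
  by move=> c /supported_psi ->; rewrite /cdot /= mul0r addr0 if_same.
by apply: eq_big_seq => c cin; rewrite /psi cin.
Qed.

(* Cauchy-Schwarz on [P] and on its complement, with weights 3/4 and 4/3 instead of
   square roots. *)
Lemma ip_le_separated (S : seq (qtm_cfg M)) (P : pred (qtm_cfg M)) (f g : qtm_cfg M -> cpx) :
  ip S f f = 1 -> ip S g g = 1 ->
  2 / 3 <= \sum_(c <- S) (if P c then cdot (f c) (f c) else 0) ->
  2 / 3 <= \sum_(c <- S) (if P c then 0 else cdot (g c) (g c)) ->
  ip S f g <= 17 / 18.
Proof.
have split2 h : ip S h h = \sum_(c <- S) (if P c then cdot (h c) (h c) else 0) +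
    \sum_(c <- S) (if P c then 0 else cdot (h c) (h c)).
  by rewrite -big_split /=; apply: eq_bigr => c _; case: (P c); rewrite ?addr0 ?add0r.
rewrite !split2; set a := \sum_(c <- S) (if P c then cdot (f c) _ else 0).
set r := \sum_(c <- S) (if P c then 0 else cdot (f c) _).
set a' := \sum_(c <- S) (if P c then cdot (g c) _ else 0).
set r' := \sum_(c <- S) (if P c then 0 else cdot (g c) _).
move=> e1 e2 h1 h2.
(* In the worst case [a = r' = 2/3] and [r = a' = 1/3], which gives 3/4 * 2/3 + 4/3 * 1/3 =
   17/18. *)
have : ip S f g <= ((3/4) * a + (4/3) * a') / 2 + ((4/3) * r + (3/4) * r') / 2.
  rewrite /ip /a /r /a' /r' !mulr_sumr -!big_split !mulr_suml -big_split /=.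
  apply: ler_sum => c _; case: (P c).
    have := @cdot_le (3/4) (4/3) (f c) (g c); lra.
  have := @cdot_le (4/3) (3/4) (f c) (g c); lra.
lra.
Qed.

Lemma overlap_le O O' y t : 2 / 3 <= acc_prob M O y t -> 2 / 3 <= rej_prob M O' y t ->
  overlap O O' y t <= 17 / 18.
Proof.
have uS : uniq (pair_support O O' y t) by exact: undup_uniq.
have sub := @pair_supportl O O' y t; have sub' := @pair_supportr O O' y t.
rewrite (acc_probE uS sub) (rej_probE uS sub'); apply: ip_le_separated.
  rewrite (ip_subset _ _ uS sub) ?q_run_uniq ?psi_norm //; exact: supported_psi.
rewrite (ip_subset _ _ uS sub') ?q_run_uniq ?psi_norm //; exact: supported_psi.
Qed.

(** Opposite correct answers force the overlap down to 17/18 by the earlier of the two halting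
    times, so at least 1/18 has been lost; costs are nonnegative, hence the sum may run on to
    [tm]. *)
Lemma swap_cost_lower (A A' : seq bool -> seq bool) y x z s w tm (b b' : Prop) :
  x != z -> (forall y, y != x -> y != z -> A y = A' y) ->
  0 < s -> 0 < w -> s * w = 1 ->
  decides A y tm b -> decides A' y tm b' -> b /\ ~ b' \/ ~ b /\ b' ->
  1 / 18 <= \sum_(u < tm) swap_cost (bool_oracle A) (bool_oracle A') y u x z s w.
Proof.
move=> xz agree s0 w0 sw1 [t [ttm [h [acc rej]]]] [t' [t'tm [h' [acc' rej']]]] bb'.
set O := bool_oracle A; set O' := bool_oracle A'.
suff : overlap O O' y (minn t t') <= 17 / 18.
  move=> hov; have := overlap_swap y (minn t t') xz agree s0 w0 sw1; rewrite -/O -/O' => ub.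
  apply: (@le_trans _ _ (\sum_(u < minn t t') swap_cost O O' y u x z s w)); first by lra.
  have mt : (minn t t' <= tm)%N by rewrite geq_min ttm.
  rewrite (big_ord_widen _ (fun u => swap_cost O O' y u x z s w) mt) big_mkcond /=.
  apply: ler_sum => u _; case: ifP => // _; rewrite /swap_cost.
  by rewrite !addr_ge0 // mulr_ge0 ?query_mass_ge0 // ltW.
case: (ltngtP t t') => [lt|lt|E].
- by rewrite (overlap_halt_lt h h' lt); lra.
- by rewrite overlapC (overlap_halt_lt h' h lt); lra.
- rewrite -E in h' acc' rej' *; case: bb' => [[hb hb']|[hb hb']].
    apply: overlap_le.
      by rewrite -two_thirdsE; apply/RleP; apply: acc.
    by rewrite -two_thirdsE; apply/RleP; apply: rej'.
  rewrite overlapC; apply: overlap_le.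
    by rewrite -two_thirdsE; apply/RleP; apply: acc'.
  by rewrite -two_thirdsE; apply/RleP; apply: rej.
Qed.

End Runs.

(** * Averaging over permutations *)

Definition upd n (A : seq bool -> seq bool) (p : {perm n.-tuple bool}) (x : seq bool) : seq bool :=
  if insub x is Some t then tval (p (t : n.-tuple bool)) else A x.

Definition lang (A : seq bool -> seq bool) (y : seq bool) : Prop :=
  exists x, size x = size y /\ A x = nseq (size y) true /\ head false x = true.

Lemma upd_in n A (p : {perm n.-tuple bool}) (t : n.-tuple bool) : upd A p t = p t.
Proof. by rewrite /upd valK. Qed.

Lemma upd_out n A (p : {perm n.-tuple bool}) x : size x != n -> upd A p x = A x.
Proof. by move=> sx; rewrite /upd insubN. Qed.

Section Adversary.
Variable n : nat.
Local Notation tup := (n.+1.-tuple bool).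
Implicit Types (p : {perm tup}) (z : tup).

Definition ones : tup := nseq_tuple n.+1 true.

Arguments ones : simpl never.

Definition preim_ones p : tup := (p^-1)%g ones.

Lemma lang_upd A p : lang (upd A p) ones <-> head false (preim_ones p) = true.
Proof.
rewrite /lang size_tuple; split=> [[x [/eqP sx [ex hx]]]|h].
  rewrite -[x]/(tval (Tuple sx)) upd_in in ex.
  suff -> : preim_ones p = Tuple sx by [].
  by apply/eqP; rewrite /preim_ones (canF_eq (permKV p)); apply/eqP/val_inj.
exists (preim_ones p); rewrite size_tuple; split=> //; split=> //.
by rewrite upd_in /preim_ones permKV.
Qed.

Definition flip z : tup := cons_tuple (~~ thead z) (behead_tuple z).

Lemma flipK : involutive flip.
Proof. by case/tupleP => b z; apply: val_inj; rewrite /= theadE negbK. Qed.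

Lemma head_flip z : head false (flip z) = ~~ head false z.
Proof. by case/tupleP: z => b z; rewrite /= theadE. Qed.

(** [flip] exchanges the tuples with the two possible first bits, so each kind makes up half of all
    tuples. *)
Lemma sum_head_neq b : \sum_(z : tup) ((head false z != b)%:R : R) = (2 ^ n.+1)%:R / 2.
Proof.
set s := \sum_(z : tup) _.
have e : \sum_(z : tup) ((head false z == b)%:R : R) = s.
  rewrite /s (reindex_inj (inv_inj flipK)); apply: eq_bigr => z _.
  by rewrite head_flip eq_sym; case: (head false z); case: (b).
have : s + s = (2 ^ n.+1)%:R.
  rewrite -{1}e -big_split /=.
  under eq_bigr => z _ do (have -> : (head false z == b)%:R + (head false z != b)%:R = 1 :> R
     by case: (_ == b); rewrite ?addr0 ?add0r).
  by rewrite sumr_const card_tuple card_bool.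
lra.
Qed.

(** Products of permutations act from left to right: the transposition comes first, so the new
    permutation sends [z] to [ones]. *)
Definition swap_pair (pz : {perm tup} * tup) : {perm tup} * tup :=
  ((tperm (preim_ones pz.1) pz.2 * pz.1)%g, preim_ones pz.1).

Lemma preim_ones_swap p z : preim_ones (tperm (preim_ones p) z * p)%g = z.
Proof.
by rewrite /preim_ones invMg permM -/(preim_ones p) tpermV tpermL.
Qed.

Lemma swap_pairK : involutive swap_pair.
Proof.
move=> [p z]; rewrite /swap_pair /= preim_ones_swap; congr (_, _).
by rewrite tpermC mulgA tperm2 mul1g.
Qed.

Variables (M : qtm) (A : seq bool -> seq bool) (tm : nat).
Hypothesis wfM : well_formed M.

Definition correct p := `[< decides M (upd A p) ones tm (lang (upd A p) ones) >].

Local Notation qm p u x := (query_mass M (bool_oracle (upd A p)) ones u (tval x) : R).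

Lemma query_mass_le1 p u z : qm p u z <= 1.
Proof.
have := sum_query_mass_le wfM (bool_oracle (upd A p)) ones u (xs := [:: tval z]) isT.
by rewrite big_seq1.
Qed.

Lemma sum_query_mass_tuple p u : \sum_(z : tup) qm p u z <= 1.
Proof.
have us : uniq (map (@tval n.+1 bool) (enum {: tup})).
  by rewrite map_inj_uniq ?enum_uniq //; exact: val_inj.
have := sum_query_mass_le wfM (bool_oracle (upd A p)) ones u us.
by rewrite big_map big_enum.
Qed.

Definition cost p z (s w : R) : R :=
  \sum_(u < tm) swap_cost M (bool_oracle (upd A p)) (bool_oracle (upd A (swap_pair (p, z)).1))
      ones u (preim_ones p) z s w.

(** The left side is positive only if both permutations are decided correctly, and then
    [swap_cost_lower] applies. *)
Lemma correct_pair_le p z s w : 0 < s -> 0 < w -> s * w = 1 ->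
  head false z != head false (preim_ones p) ->
  (correct p)%:R + (correct (swap_pair (p, z)).1)%:R - 1 <= 18 * cost p z s w.
Proof.
move=> s0 w0 sw hz.
have c0 : 0 <= cost p z s w.
  apply: sumr_ge0 => u _; rewrite /swap_cost.
  by rewrite !addr_ge0 // mulr_ge0 ?query_mass_ge0 // ltW.
case: (boolP (correct p)) => [/asboolP c1|_]; last by case: (correct _) => /=; lra.
case: (boolP (correct _)) => [/asboolP c2|_] /=; last by lra.
have xz : tval (preim_ones p) != tval z by apply: contra hz => /eqP ->.
have := swap_cost_lower wfM xz _ s0 w0 sw c1 c2; rewrite -/(cost p z s w) => low.
have : 1 / 18 <= cost p z s w; last by lra.
apply: low.
  move=> y yx yz; rewrite /upd; case: insubP => // t _ ty; rewrite /= permM tpermD //.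
    by rewrite eq_sym -val_eqE /= ty.
  by rewrite eq_sym -val_eqE /= ty.
(* The string of ones has preimage [z] under the swapped permutation, so [hz] makes the two answers
   opposite. *)
rewrite !lang_upd preim_ones_swap; case: (head false z) hz; case: (head false _) => // _.
  by right; split.
by left; split.
Qed.

Lemma sum_cost_le s w : 0 < s -> 0 < w ->
  \sum_(p : {perm tup}) \sum_(z : tup) cost p z s w <=
    tm%:R * (#|{perm tup}|%:R * (2 * (s * (2 ^ n.+1)%:R + w))).
Proof.
move=> s0 w0; set N : R := (2 ^ n.+1)%:R; set P : R := #|{perm tup}|%:R.
rewrite /cost; under eq_bigr do rewrite exchange_big.
rewrite exchange_big.
have -> : tm%:R * (P * (2 * (s * N + w))) = \sum_(u < tm) (P * (2 * (s * N + w))).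
  by rewrite sumr_const card_ord mulr_natl.
apply: ler_sum => u _; rewrite /swap_cost.
(* The preimage does not vary with [z], so each of the [N] choices of [z] may cost the full query
   mass 1. *)
have h1 : \sum_(p : {perm tup}) \sum_(z : tup) s * qm p u (preim_ones p) <= P * (s * N).
  rewrite /P -sumr_const mulr_suml; apply: ler_sum => p _.
  rewrite mul1r sumr_const card_tuple card_bool -mulr_natr.
  by rewrite ler_wpM2r ?ler0n // -[leRHS]mulr1 ler_wpM2l ?query_mass_le1 // ltW.
have h2 : \sum_(p : {perm tup}) \sum_(z : tup) w * qm p u z <= P * w.
  rewrite /P -sumr_const mulr_suml; apply: ler_sum => p _.
  by rewrite mul1r -mulr_sumr -[leRHS]mulr1 ler_wpM2l ?sum_query_mass_tuple // ltW.
(* The terms of the second run become those of the first by reindexing along the involution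
   [swap_pair]. *)
have h3 : \sum_(p : {perm tup}) \sum_(z : tup) w * qm (swap_pair (p, z)).1 u (preim_ones p) = \sum_(p : {perm tup}) \sum_(z : tup) w * qm p u z.
  rewrite [RHS]pair_bigA [LHS]pair_bigA [RHS](reindex_inj (inv_inj swap_pairK)) /=.
  by apply: eq_bigr => -[p z].
have h4 : \sum_(p : {perm tup}) \sum_(z : tup) s * qm (swap_pair (p, z)).1 u z = \sum_(p : {perm tup}) \sum_(z : tup) s * qm p u (preim_ones p).
  rewrite [RHS]pair_bigA [LHS]pair_bigA [RHS](reindex_inj (inv_inj swap_pairK)) /=.
  by apply: eq_bigr => -[p z] _; rewrite /= preim_ones_swap.
have h1' := h1; have h2' := h2; rewrite -h4 in h1'; rewrite -h3 in h2'.
have := lerD (lerD h1 h2') (lerD h2 h1').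
rewrite -!big_split /=; under [X in X <= _ -> _]eq_bigr do rewrite -!big_split /=.
by move=> h; apply: (le_trans h); clear; lra.
Qed.

Lemma correct_fraction :
  (288 * tm.+1%:R) ^+ 2 <= (2 ^ n.+1)%:R :> R ->
  \sum_(p : {perm tup}) ((correct p)%:R : R) <= 3 / 4 * #|{perm tup}|%:R.
Proof.
set N : R := (2 ^ n.+1)%:R; set P : R := #|{perm tup}|%:R; set t : R := tm.+1%:R => hN.
have t1 : 1 <= t by rewrite ler1n.
have N0 : 0 < N by apply: lt_le_trans hN; rewrite exprn_gt0 // mulr_gt0 // (lt_le_trans ltr01).
have P0 : 0 <= P by apply: ler0n.
(* [hN] reads [w ^+ 2 <= N]. With [s = 1 / w] both [tm * s] and [tm * w / N] are at most 1/288, so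
   the total cost is at most [P * N / 72], and 18 times it is [P * N / 4]. *)
set w := 288 * t; have w0 : 0 < w by rewrite /w; lra.
set s := w^-1; have s0 : 0 < s by rewrite invr_gt0.
have sw : s * w = 1 by rewrite mulVf // gt_eqF.
have ub := sum_cost_le s0 w0; rewrite -/N -/P in ub.
set G := \sum_(p : {perm tup}) _.
(* [correct_pair_le] is summed over the pairs with different first bits, half of all pairs; the
   involution gives both correctness terms the same sum. *)
have lb : G * N - P * N / 2 <= 18 * \sum_(p : {perm tup}) \sum_(z : tup) cost p z s w.
  pose d (p : {perm tup}) (z : tup) : R := (head false z != head false (preim_ones p))%:R.
  have dE : \sum_(p : {perm tup}) \sum_(z : tup) d p z * ((correct p)%:R + (correct (swap_pair (p, z)).1)%:R - 1)
      = G * N - P * N / 2.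
    have e1 : \sum_(p : {perm tup}) \sum_(z : tup) d p z * (correct p)%:R = G * (N / 2).
      rewrite /G mulr_suml; apply: eq_bigr => p _.
      by rewrite -mulr_suml sum_head_neq mulrC.
    have e2 : \sum_(p : {perm tup}) \sum_(z : tup) d p z * (correct (swap_pair (p, z)).1)%:R = G * (N / 2).
      rewrite -e1 [RHS]pair_bigA [LHS]pair_bigA [RHS](reindex_inj (inv_inj swap_pairK)) /=.
      by apply: eq_bigr => -[p z] _; rewrite /d /= preim_ones_swap eq_sym.
    have e3 : \sum_(p : {perm tup}) \sum_(z : tup) d p z = P * (N / 2).
      under eq_bigr do rewrite sum_head_neq.
      by rewrite sumr_const -[LHS]mulr_natl.
    transitivity (\sum_(p : {perm tup}) \sum_(z : tup) d p z * (correct p)%:R +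
        \sum_(p : {perm tup}) \sum_(z : tup) d p z * (correct (swap_pair (p, z)).1)%:R - \sum_(p : {perm tup}) \sum_(z : tup) d p z).
      rewrite -big_split -sumrB; apply: eq_bigr => p _; rewrite -big_split -sumrB.
      by apply: eq_bigr => z _ /=; ring.
    rewrite e1 e2 e3; lra.
  rewrite -dE mulr_sumr; apply: ler_sum => p _; rewrite mulr_sumr; apply: ler_sum => z _.
  rewrite /d; case: (boolP (_ != _)) => hz; first by rewrite mul1r; apply: correct_pair_le.
  (* Pairs with equal first bits contribute nothing on the left and a nonnegative cost on the
     right. *)
  rewrite mul0r mulr_ge0 //; apply: sumr_ge0 => u _; rewrite /swap_cost.
  by rewrite !addr_ge0 // mulr_ge0 ?query_mass_ge0 // ltW.
have tms : tm%:R * s <= 1 / 288.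
  have -> : 1 / 288 = (t * s) :> R by rewrite /s /w; field; lra.
  by rewrite (ler_wpM2r (ltW s0)) // ler_nat.
have tmw : tm%:R * w <= N / 288.
  have : tm%:R * w <= w / 288 * w.
    by rewrite ler_wpM2r ?(ltW w0) // /w mulrAC divff ?mul1r ?ler_nat // pnatr_eq0.
  move: hN; rewrite -/w expr2; lra.
have : G * N <= (3 / 4 * P) * N; last by rewrite ler_pM2r.
have : tm%:R * (P * (2 * (s * N + w))) <= P * (N * (1 / 72)).
  have -> : tm%:R * (P * (2 * (s * N + w))) = P * (2 * (tm%:R * s * N + tm%:R * w)) by ring.
  rewrite ler_wpM2l //.
  have : tm%:R * s * N <= 1 / 288 * N by rewrite (ler_wpM2r (ltW N0)).
  lra.
lra.
Qed.

End Adversary.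

(** * Null sets of permutation oracles *)

Lemma size_finsupp_write (G : alphabet) (t : tape G) i g :
  (size (finsupp (write_cell t i g)) <= (size (finsupp t)).+1)%N.
Proof.
rewrite -!/(#|` _|)%fset finsupp_with; case: ifP => _.
  by rewrite leqW // [leqRHS](cardfsD1 i) leq_addl.
by rewrite cardfsU1; case: (i \notin _).
Qed.

Lemma size_read_bits (G : alphabet) (t : tape G) fuel i :
  (size (read_bits_from t i fuel) <= fuel)%N.
Proof. by elim: fuel i => //= f IHf i; case: (decode_sym _) => //= b; rewrite ltnS. Qed.

(** [tape_bits] reads at most [u.+1] symbols; one of them is the answer bit, and unpairing only
    shortens the rest. *)
Lemma size_query_string M (c : qtm_cfg M) u s :
  (size (finsupp (let: (_, _, _, t2, _) := c in t2)) <= u)%N ->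
  query_string c = Some s -> (size s <= u)%N.
Proof.
case: c => [[[[q t1] h1] t2] h2] /= hu; case: ifP => // _.
have := size_read_bits t2 (size (finsupp t2)).+1 (Posz 0); rewrite -/(tape_bits t2).
case: (tape_bits t2) => // b s' /= hs; rewrite /unpair; case: ifP => // _ [<-].
rewrite size_drop size_take /= ltnS leqnn; lia.
Qed.

Definition agree k (A B : seq bool -> seq bool) := forall x, (size x < k)%N -> A x = B x.

(** The query tape starts empty and a step writes at most one of its cells, so a query in step
    [t.+1] concerns a string of length at most [t < k]. The bound on the support carries the
    induction. *)
Lemma q_run_agree M A B y k t : agree k A B -> (t <= k)%N ->
  q_run M (bool_oracle A) y t = q_run M (bool_oracle B) y t /\
  forall c, c \in (q_run M (bool_oracle A) y t).1 ->
    (size (finsupp (let: (_, _, _, t2, _) := c in t2)) <= t)%N.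
Proof.
move=> AB; elim: t => [|t IHt] tk.
  split=> // c; rewrite inE => /eqP -> /=.
  by rewrite /empty_tape finsupp0.
have [eqr bnd] := IHt (ltnW tk).
have qs c : c \in (q_run M (bool_oracle A) y t).1 ->
    forall s, query_string c = Some s -> A s = B s.
  by move=> /bnd hc s /(size_query_string hc) hs; apply: AB; apply: leq_ltn_trans tk.
split.
  rewrite /q_run !iterS -!/(q_run _ _ _ _) -eqr /evolve; congr (_, _).
    congr (undup (flatten _)); apply/eq_in_map => c /qs {}qs.
    move: qs; case: c => [[[[q t1] h1] t2] h2] /=; rewrite /q_succs /q_oracle_apply /=.
    case: ifP => // _; case: (tape_bits t2) => // b s.
    rewrite /bool_oracle; case: (unpair _) => [[z i]|] //= /(_ z erefl) -> //.
  apply: funext => c'; apply: eq_csum => c /qs {}qs; congr cmul.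
  exact: q_step_amp_agree.
move=> c'; rewrite /q_run iterS -/(q_run _ _ _ _) mem_undup => /flattenP [l /mapP[c cin ->]].
move: (bnd c cin) => {}bnd; rewrite /q_succs; case: ifP => _.
  rewrite inE => /eqP ->; move: bnd; case: (c) => [[[[q t1] h1] t2] h2] /= bnd.
  case: (tape_bits t2) => [|b s] /=; first exact: leqW.
  by apply: leq_trans (size_finsupp_write _ _ _) _; rewrite ltnS.
move=> /mapP[r _ ->]; move: bnd; case: (c) => [[[[q t1] h1] t2] h2] /= bnd.
case: r => [[[[q' g1] g2] d1] d2] /=.
by apply: leq_trans (size_finsupp_write _ _ _) _; rewrite ltnS.
Qed.

Lemma decides_agree M A B y k tm b : agree k A B -> (tm <= k)%N ->
  decides M A y tm b -> decides M B y tm b.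
Proof.
move=> AB tmk [t [ttm dec]]; exists t; split; first exact: ttm.
move: dec; have eqr u : (u <= t)%N -> q_run M (bool_oracle A) y u = q_run M (bool_oracle B) y u.
  by move=> ut; have [] := q_run_agree M y AB (leq_trans ut (leq_trans ttm tmk)).
rewrite /q_halts_at /acc_prob /rej_prob (eqr t (leqnn t)).
move=> [[h1 h2] h3]; split; last exact: h3.
split; first exact: h1.
by move=> u ut; rewrite -(eqr u (ltnW ut)); apply: h2.
Qed.

Lemma lang_agree A B y k : agree k A B -> (size y < k)%N -> lang A y -> lang B y.
Proof. by move=> AB yk [x [sx [ex hx]]]; exists x; rewrite -AB ?sx. Qed.

Lemma decides_iff M A y tm (b b' : Prop) : (b <-> b') -> decides M A y tm b -> decides M A y tm b'.
Proof. by move=> bb' [t [h1 [h2 [h3 h4]]]]; exists t; do 3!split=> //; rewrite -bb'. Qed.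

Lemma agree_sym k A B : agree k A B -> agree k B A.
Proof. by move=> AB x xk; rewrite AB. Qed.

Lemma agree_le k l A B : (k <= l)%N -> agree l A B -> agree k A B.
Proof. by move=> kl AB x xk; apply: AB; apply: leq_trans xk kl. Qed.

Lemma agree_upd k n A (p : {perm n.-tuple bool}) : (k <= n)%N -> agree k (upd A p) A.
Proof. by move=> kn x xk; rewrite upd_out // ltn_eqF // (leq_trans xk). Qed.

Lemma upd_upd n A (p p' : {perm n.-tuple bool}) : upd (upd A p) p' = upd A p'.
Proof. by apply: funext => x; rewrite /upd; case: insubP. Qed.

Lemma updC m n A (p : {perm m.-tuple bool}) (p' : {perm n.-tuple bool}) :
  m != n -> upd (upd A p) p' = upd (upd A p') p.
Proof.
move=> mn; apply: funext => x; case: (eqVneq (size x) n) => [/eqP xn|xn].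
  rewrite [RHS]upd_out; last by rewrite (eqP xn) eq_sym.
  by rewrite -[x]/(tval (Tuple xn)) !upd_in.
rewrite [LHS]upd_out //; case: (eqVneq (size x) m) => [/eqP xm|xm].
  by rewrite -[x]/(tval (Tuple xm)) !upd_in.
by rewrite !upd_out.
Qed.

(** * Averages over random permutation oracles *)

Definition avg (I : finType) (f : I -> R) : R := (\sum_i f i) / #|I|%:R.

Lemma avg_const (I : finType) (a : R) : (0 < #|I|)%N -> avg (fun _ : I => a) = a.
Proof.
move=> I0; rewrite /avg sumr_const -[a *+ _]mulr_natr mulfK // pnatr_eq0 -lt0n; exact: I0.
Qed.

Lemma card_perm_tuple n : #|{perm n.-tuple bool}| = ((2 ^ n)`!)%N.
Proof.
have -> : #|{perm n.-tuple bool}| = #|perm_on [set: n.-tuple bool]|.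
  by apply: eq_card => p; rewrite !inE; apply/esym/subsetP => x; rewrite !inE.
by rewrite card_perm cardsT card_tuple card_bool.
Qed.

(** The expectation over independent uniform permutations at the lengths below [k], the oracle being
    the identity at all other lengths. *)
Fixpoint expect k (f : (seq bool -> seq bool) -> R) : R :=
  if k is k'.+1 then expect k' (fun A => avg (fun p : {perm k'.-tuple bool} => f (upd A p)))
  else f id.

Lemma expect_le k f g : (forall A, f A <= g A) -> expect k f <= expect k g.
Proof.
elim: k f g => [|k IHk] f g fg /=; first exact: fg.
apply: IHk => A; rewrite /avg ler_wpM2r ?invr_ge0 ?ler0n //.
by apply: ler_sum => p _; apply: fg.
Qed.

Lemma expectZ k f (a : R) : expect k (fun A => f A * a) = expect k f * a.
Proof.
elim: k f => //= k IHk f; rewrite -IHk; congr expect; apply: funext => A.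
by rewrite /avg -mulr_suml mulrAC.
Qed.

(** At the top length a second update overrides the first; at a smaller length it commutes with the
    updates above it. *)
Lemma expect_resample k n f : (n < k)%N ->
  expect k f = expect k (fun A => avg (fun p : {perm n.-tuple bool} => f (upd A p))).
Proof.
elim: k f => // k IHk f; rewrite ltnS leq_eqVlt => /orP[/eqP ->|nk] /=.
  congr expect; apply: funext => A.
  rewrite -[LHS](@avg_const {perm k.-tuple bool}) ?card_perm_tuple ?fact_gt0 //.
  congr avg; apply: funext => p; congr avg; apply: funext => p'.
  by rewrite upd_upd.
rewrite (IHk _ nk); congr expect; apply: funext => A.
rewrite /avg -!mulr_suml exchange_big /= mulrAC; congr (_ / _ / _).
apply: eq_bigr => p _; apply: eq_bigr => p' _.
by rewrite updC // ltn_eqF.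
Qed.

Definition depends_below k (S : (seq bool -> seq bool) -> Prop) :=
  forall A B, agree k A B -> S A -> S B.

Definition indic (S : (seq bool -> seq bool) -> Prop) A : R := (`[< S A >])%:R.

Lemma indic_agree k S A B : depends_below k S -> agree k A B -> indic S A = indic S B.
Proof.
move=> dS AB; rewrite /indic; congr ((nat_of_bool _)%:R); apply/asboolP/asboolP; apply: dS => //.
exact: agree_sym.
Qed.

(** Averaging over a length that [S] does not see is averaging a constant. *)
Lemma expect_indic_le k l S : depends_below k S -> (k <= l)%N ->
  expect l (indic S) = expect k (indic S).
Proof.
move=> dS; elim: l => [|l IHl]; first by rewrite leqn0 => /eqP ->.
rewrite leq_eqVlt => /orP[/eqP -> //|kl]; rewrite -IHl //=.
congr expect; apply: funext => A.
transitivity (avg (fun _ : {perm l.-tuple bool} => indic S A)).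
  congr avg; apply: funext => p; apply: indic_agree dS _; exact: agree_upd.
by rewrite avg_const // card_perm_tuple fact_gt0.
Qed.

Fixpoint oracles k : seq (seq bool -> seq bool) :=
  if k is k'.+1 then [seq upd A p | A <- oracles k', p <- enum {: {perm k'.-tuple bool}}]
  else [:: id].

(* The powers in [cyl_weight] and [NP_rel] elaborate to Stdlib's [Nat.pow]. *)
Lemma NatpowE m n : Nat.pow m n = (m ^ n)%N.
Proof. by elim: n => //= n ->; rewrite expnS. Qed.

Lemma cyl_weightS k : cyl_weight k.+1 = cyl_weight k / ((2 ^ k)`!)%:R.
Proof.
rewrite /cyl_weight -[k.+1]addn1 iotaD foldr_cat /= add0n.
set a := Rmult _ _; have -> : a = 1 * ((2 ^ k)`!)%:R^-1.
  by rewrite /a RmultE RinvE INRE R1E NatpowE mulrC.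
elim: (iota 0 k) => [|n s IHs] /=; first by rewrite R1E.
by rewrite IHs !RmultE mulrA.
Qed.

Lemma cyl_weight_gt0 k : 0 < cyl_weight k.
Proof.
elim: k => [|k IHk]; first exact: ltr01.
by rewrite cyl_weightS divr_gt0 // ltr0n fact_gt0.
Qed.

(** Averaging at length [k] divides by [(2 ^ k)!], the factor between consecutive cylinder weights.
    Expectations thus become total weights of cylinders. *)
Lemma expectE k f : expect k f = \sum_(A <- oracles k) f A * cyl_weight k.
Proof.
elim: k f => [|k IHk] f /=; first by rewrite big_seq1 mulr1.
rewrite IHk big_allpairs_dep /=; apply: eq_bigr => A _.
by rewrite cyl_weightS /avg -card_perm_tuple -mulr_suml big_enum /= mulrAC mulrA.
Qed.

Lemma perm_oracle_id : perm_oracle id.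
Proof. by split=> //; split=> // y; exists y. Qed.

Lemma perm_oracle_upd n A (p : {perm n.-tuple bool}) : perm_oracle A -> perm_oracle (upd A p).
Proof.
move=> [sA [iA uA]].
have sU x : size (upd A p x) = size x.
  case: (eqVneq (size x) n) => [/eqP sx|nx]; last by rewrite upd_out.
  by rewrite -[x]/(tval (Tuple sx)) upd_in !size_tuple.
split=> //; split=> [x y sxy|y].
  case: (eqVneq (size x) n) => [/eqP sx|nx]; last first.
    by rewrite !upd_out -?sxy //; apply: iA.
  have /eqP sy : size y = n by rewrite -sxy (eqP sx).
  rewrite -[x]/(tval (Tuple sx)) -[y]/(tval (Tuple sy)) !upd_in.
  by move=> /val_inj /perm_inj ->.
case: (eqVneq (size y) n) => [/eqP sy|ny].
  exists ((p^-1)%g (Tuple sy)); rewrite size_tuple upd_in permKV; split=> //.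
  by rewrite (eqP sy).
have [x [sx <-]] := uA y; exists x; split; first by rewrite sA.
by rewrite upd_out // sx.
Qed.

Lemma oracles_perm k A : List.In A (oracles k) -> perm_oracle A.
Proof.
elim: k A => [|k IHk] A /=; first by move=> [<-|//]; apply: perm_oracle_id.
elim: (oracles k) IHk => //= B s IHs IHk.
rewrite List.in_app_iff List.in_map_iff => -[[p [<- _]]|].
  by apply: perm_oracle_upd; apply: IHk; left.
by apply: IHs => C Cs; apply: IHk; right.
Qed.

Lemma mem_In (T : eqType) (x : T) s : x \in s -> List.In x s.
Proof. by elim: s => //= y s IHs; rewrite inE => /orP[/eqP ->|/IHs]; [left|right]. Qed.

(** At each length [A] is an injective self-map of a finite set, hence one of the enumerated
    permutations. *)
Lemma oracles_cover k A : perm_oracle A ->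
  exists2 B, List.In B (oracles k) & agree k A B.
Proof.
move=> [sA [iA uA]]; elim: k => [|k [B inB AB]]; first by exists id; [left|].
pose g (t : k.-tuple bool) : k.-tuple bool := insubd t (A t).
have gE t : tval (g t) = A t.
  by rewrite /g val_insubd sA size_tuple eqxx.
have ginj : injective g.
  move=> t t' e; apply: val_inj; apply: iA; first by rewrite !size_tuple.
  by rewrite -!gE e.
exists (upd B (perm ginj)).
  rewrite /=; elim: (oracles k) inB => //= C s IHs [->|/IHs h].
    rewrite List.in_app_iff; left; apply/List.in_map_iff; exists (perm ginj); split=> //.
    by apply: mem_In; rewrite mem_enum.
  by rewrite List.in_app_iff; right.
move=> x; rewrite ltnS leq_eqVlt => /orP[/eqP sx|xk]; last first.
  by rewrite upd_out ?AB // ltn_eqF.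
have sx' : size x == k by rewrite sx.
by rewrite -[x]/(tval (Tuple sx')) upd_in permE gE.
Qed.

(** * The growth bound and the success probability of one machine *)

Lemma IZR2E : IZR 2 = 2 :> R.
Proof. by rewrite -[RHS]INRE INR_IZR_INZ. Qed.

Lemma little_o_dominated (T : nat -> nat) : little_o_2pow_third T ->
  exists N, forall n, (N <= n)%N -> (288 * (T n).+1%:R) ^+ 2 <= (2 ^ n)%:R :> R.
Proof.
(* With [p = 2 ^ (n / 3)] and [T n <= p / 600], the bound [288 * (T n + 1) <= p] follows once
   [p >= 600]; [n >= 30] gives [p >= 2 ^ 10]. *)
move=> oT; have e0 : Rlt (IZR 0) (Rinv (INR 600)).
  by apply: Rinv_0_lt_compat; apply: lt_0_INR; apply/ssrnat.ltP.
have [N hN] := oT _ e0; exists (maxn N 30) => n; rewrite geq_max => /andP[Nn n30].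
have := hN n Nn; set p := Rpower _ _ => /RleP; rewrite RmultE RinvE !INRE => hT.
have ln2 : Rlt (IZR 1) (IZR 2) by apply: IZR_lt.
have p2 : p ^+ 2 <= (2 ^ n)%:R.
  have e2 : Rpower (IZR 2) (INR n) = (2 ^ n)%:R.
    by rewrite Rpower_pow ?RpowE ?IZR2E ?natrX //; rewrite -IZR2E; apply: IZR_lt.
  rewrite -e2 expr2 -RmultE /p -Rpower_plus; apply/RleP/Rle_Rpower.
    by apply: Rlt_le.
  have := pos_INR n; Lra.lra.
have p600 : 600 <= p.
  have -> : 600 = INR 600 by rewrite INRE.
  apply: (@le_trans _ _ (Rpower (IZR 2) (INR 10))).
    rewrite Rpower_pow; last by apply: IZR_lt.
    by rewrite INRE RpowE IZR2E -natrX ler_nat.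
  apply/RleP/Rle_Rpower; first by apply: Rlt_le.
  have : Rle (INR 30) (INR n) by apply: le_INR; apply/ssrnat.leP.
  rewrite !INR_IZR_INZ /=; Lra.lra.
apply: le_trans p2; rewrite ler_pXn2r ?nnegrE ?mulr_ge0 ?ler0n //; last lra.
rewrite -natr1; lra.
Qed.

Definition decides_all M T A := forall y, decides M A y (T (size y)) (lang A y).

(** Induction on the number of test lengths: each new test input lies beyond everything the earlier
    events depend on, so resampling at its length leaves them fixed and [correct_fraction] gives a
    further factor 3/4. *)
Lemma decides_all_small M T : well_formed M -> little_o_2pow_third T ->
  forall m, exists k S, [/\ depends_below k S, expect k (indic S) <= (3 / 4) ^+ m &
    forall A, decides_all M T A -> S A].
Proof.
move=> wfM /little_o_dominated [N hN]; elim=> [|m [k [S [dS eS cS]]]].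
  exists 0%N, (fun _ => True); split=> //=; rewrite expr0 /indic.
  by rewrite -[leRHS]/((true : nat)%:R) ler_nat; case: (asbool _).
pose n := maxn k N; pose y := tval (ones n).
have sy : size y = n.+1 by rewrite /y size_tuple.
pose C A := decides M A y (T n.+1) (lang A y).
(* Below [l] the oracle determines both the membership of [y], of length [n.+1], and all runs of
   [T n.+1] steps. *)
pose l := maxn n.+2 (T n.+1); exists l, (fun A => S A /\ C A).
have kn : (k <= n)%N by rewrite /n leq_maxl.
have nl : (n.+1 < l)%N by rewrite /l leq_maxl.
have kl : (k <= l)%N by apply: leq_trans kn (leq_trans (leqnSn n) (ltnW nl)).
split.
- move=> A B AB [SA CA]; split; first by apply: dS SA; apply: agree_le AB.
  have yl : (size y < l)%N by rewrite sy.
  apply: (@decides_iff _ _ _ _ (lang A y)).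
    by split; apply: lang_agree yl => //; apply: agree_sym.
  by apply: decides_agree AB _ CA; rewrite /l leq_maxr.
- rewrite (expect_resample _ nl) exprSr.
  apply: (@le_trans _ _ (expect l (fun A => indic S A * (3 / 4)))); last first.
    by rewrite expectZ (expect_indic_le dS kl) ler_wpM2r //; lra.
  apply: expect_le => A.
  have h := correct_fraction A wfM (hN n.+1 (leq_trans (leq_maxr k N) (leqnSn _))).
  have P0 : 0 < (#|{perm n.+1.-tuple bool}|)%:R :> R by rewrite ltr0n card_perm_tuple fact_gt0.
  rewrite /avg ler_pdivrMr // -mulrA; apply: le_trans (ler_wpM2l _ h); last by rewrite ler0n.
  rewrite mulr_sumr; apply: ler_sum => p _.
  rewrite -(indic_agree dS (agree_upd A p (leqW kn))) /indic /correct -/y -/(C _).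
  by rewrite -natrM ler_nat mulnb asbool_and.
- by move=> A dA; split; [apply: cS|rewrite /C -sy; apply: dA].
Qed.

(** * Covers by cylinders and countable unions *)

Lemma pow_small (x e : R) : 0 < x -> x < 1 -> 0 < e -> exists n, x ^+ n <= e.
Proof.
move=> x0 x1 e0.
have xx : Rlt (Rabs x) (IZR 1) by rewrite Rabs_pos_eq; [apply/RltP|apply/RleP/ltW].
have /RltP e0' := e0; have [n hn] := pow_lt_1_zero x xx e e0'.
exists n; have := hn n (le_n n); rewrite RpowE RabsE => /RltP /ltW.
by rewrite ger0_norm // exprn_ge0 // ltW.
Qed.

Definition finitely_coverable (N : (seq bool -> seq bool) -> Prop) : Prop :=
  forall e : R, 0 < e -> exists s : seq ((seq bool -> seq bool) * nat),
    [/\ forall q, List.In q s -> perm_oracle q.1,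
        forall A, perm_oracle A -> N A -> exists2 q, List.In q s & cylinder q.1 q.2 A &
        \sum_(q <- s) cyl_weight q.2 <= e].

(** The cover consists of the cylinders based at those members of [oracles k] that satisfy [S]; by
    [expectE] their total weight is the expectation of [indic S]. *)
Lemma decides_all_coverable M T : well_formed M -> little_o_2pow_third T ->
  finitely_coverable (decides_all M T).
Proof.
move=> wfM oT e e0; have [||m hm] := @pow_small (3 / 4) e _ _ e0; try lra.
have [k [S [dS eS cS]]] := decides_all_small wfM oT m.
exists [seq (A, k) | A <- oracles k & `[< S A >]]; split.
- by move=> q /List.in_map_iff [A [<- /List.filter_In [/oracles_perm pA _]]].
- move=> A pA /cS SA; have [B inB AB] := oracles_cover k pA.
  exists (B, k); last by [].
  apply/List.in_map_iff; exists B; split=> //; apply/List.filter_In; split=> //.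
  by apply/asboolP; apply: dS SA.
- rewrite big_map big_filter big_mkcond /=; apply: le_trans hm; apply: le_trans eS.
  rewrite expectE; apply: ler_sum => A _; rewrite /indic.
  by case: (asbool _); rewrite ?mul1r ?mul0r.
Qed.

Lemma cyl_weight_small (e : R) : 0 < e -> exists k, cyl_weight k <= e.
Proof.
move=> e0; have [||n hn] := @pow_small (1 / 2) e _ _ e0; try lra.
(* Length 0 has the factor 1/1! = 1, hence the shift by one; every later length at least halves the
   weight. *)
exists n.+1; apply: le_trans hn; elim: n => [|n IHn].
  by rewrite cyl_weightS /cyl_weight /= R1E divr1 expr0.
rewrite cyl_weightS exprSr; apply: ler_pM => //.
- exact: ltW (cyl_weight_gt0 _).
- by rewrite invr_ge0 ler0n.
have f2 : (2 <= (2 ^ n.+1)`!)%N.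
  by apply: (@leq_trans (2 ^ n.+1)); [rewrite expnS leq_pmulr ?expn_gt0|apply: fact_geq].
rewrite div1r lef_pV2 ?posrE ?ltr0n ?fact_gt0 //.
by rewrite ler_nat.
Qed.

Lemma sum_halves n : \sum_(i < n) ((1 / 2) ^+ i.+1 : R) <= 1.
Proof.
suff -> : \sum_(i < n) ((1 / 2) ^+ i.+1 : R) = 1 - (1 / 2) ^+ n.
  by rewrite gerBl exprn_ge0 //; lra.
elim: n => [|n IHn]; first by rewrite big_ord0 expr0 subrr.
rewrite big_ord_recr /= IHn exprS; lra.
Qed.

Lemma In_nthP (T : Type) (x0 x : T) s : List.In x s -> exists2 j, (j < size s)%N & nth x0 s j = x.
Proof.
elim: s => [|a s IHs]; first by [].
by case=> [<-|/IHs [j js <-]]; [exists 0%N | exists j.+1].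
Qed.

(** The set of index [i] gets a cover of weight at most [e / 2 ^ (i + 1)], and the finite covers are
    concatenated into one sequence. *)
Lemma countable_union_null (N : nat -> (seq bool -> seq bool) -> Prop) :
  (forall i, finitely_coverable (N i)) -> perm_null (fun A => exists i, N i A).
Proof.
move=> cN e /RltP e0; have e0' : 0 < e by [].
pose d i : R := e * (1 / 2) ^+ i.+1.
have d0 i : 0 < d i by rewrite mulr_gt0 // exprn_gt0 //; lra.
(* [perm_null] asks for an infinite sequence of cylinders. One extra small cylinder makes each cover
   nonempty, so the first [j] covers supply at least [j] entries. *)
have ex i : exists s : seq ((seq bool -> seq bool) * nat),
    [/\ forall q, List.In q s -> perm_oracle q.1,
        forall A, perm_oracle A -> N i A -> exists2 q, List.In q s & cylinder q.1 q.2 A,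
        \sum_(q <- s) cyl_weight q.2 <= d i & (0 < size s)%N].
  have d2 : 0 < d i / 2 by rewrite divr_gt0.
  have [s [ps cs ws]] := cN i _ d2; have [k hk] := cyl_weight_small d2.
  exists ((id, k) :: s); split=> //.
  - by move=> q [<-|/ps //]; apply: perm_oracle_id.
  - by move=> A pA NA; have [q qs qA] := cs A pA NA; exists q => //; right.
  - rewrite big_cons /=; lra.
pose s i := sval (cid (ex i)).
have sP i := svalP (cid (ex i)); rewrite -/(s _) in sP.
pose F j := flatten [seq s i | i <- iota 0 j].
have FS j : F j.+1 = F j ++ s j.
  by rewrite /F -[j.+1]addn1 iotaD map_cat flatten_cat /= cats0 add0n.
have sizeF j : (j <= size (F j))%N.
  elim: j => // j IHj; rewrite FS size_cat -addn1 leq_add //.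
  by have [] := sP j.
have prefF a b q0 j : (a <= b)%N -> (j < size (F a))%N -> nth q0 (F b) j = nth q0 (F a) j.
  move=> ab ja; elim: b ab => [|b IHb]; first by rewrite leqn0 => /eqP ->.
  rewrite leq_eqVlt => /orP[/eqP -> //|ab]; rewrite -IHb // FS nth_cat.
  suff -> : (j < size (F b))%N by [].
  apply: leq_trans ja _; move: ab; rewrite ltnS; clear IHb; elim: b => [|b IHb].
    by rewrite leqn0 => /eqP ->.
  by rewrite leq_eqVlt => /orP[/eqP -> //|/IHb h]; rewrite FS size_cat (leq_trans h) ?leq_addr.
pose q0 : (seq bool -> seq bool) * nat := (id, 0%N).
(* [F j.+1] has more than [j] entries, so the default is never read, and by [prefF] longer prefixes
   give the same entry. *)
pose q j := nth q0 (F j.+1) j.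
have inF j p : List.In p (F j) -> exists2 i, (i < j)%N & List.In p (s i).
  elim: j => // j IHj; rewrite FS List.in_app_iff => -[/IHj [i ij h]|h].
    by exists i => //; apply: leqW.
  by exists j.
have nthIn (l : seq ((seq bool -> seq bool) * nat)) j : (j < size l)%N -> List.In (nth q0 l j) l.
  by elim: l j => //= a l IHl [|j] jl; [left|right; apply: IHl].
exists (fun j => (q j).1), (fun j => (q j).2); split; [|split].
- move=> j; have [i _ qi] := inF _ _ (nthIn _ _ (sizeF j.+1)).
  by have [ps _ _ _] := sP i; apply: ps.
- move=> A pA [i NA]; have [_ cs _ _] := sP i; have [p ps pAc] := cs A pA NA.
  have [j jl pj] := In_nthP q0 ps.
  (* The cover of index [i] starts at position [size (F i)]. *)
  exists (size (F i) + j)%N; rewrite /q (prefF i.+1).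
  + by rewrite FS nth_cat ltnNge leq_addr /= addKn pj.
  + by rewrite ltnS (leq_trans (sizeF i)) ?leq_addr.
  + by rewrite FS size_cat ltn_add2l.
- move=> J; apply/RleP; rewrite rsumE.
  have -> : iota 0 J = index_iota 0 J by rewrite /index_iota subn0.
  rewrite big_mkord.
  have -> : \sum_(j < J) cyl_weight (q j).2 = \sum_(j < J) cyl_weight (nth q0 (F J) j).2.
    by apply: eq_bigr => j _; rewrite /q -(prefF j.+1 J) ?sizeF.
  (* The first [J] entries are among those of [F J], whose weight is then bounded cover by cover. *)
  apply: (@le_trans _ _ (\sum_(p <- F J) cyl_weight p.2)).
    rewrite [leRHS](big_nth q0) big_mkord (big_ord_widen _ (fun j => cyl_weight (nth q0 (F J) j).2) (sizeF J)).
    rewrite big_mkcond; apply: ler_sum => j _; case: ifP => // _.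
    exact: ltW (cyl_weight_gt0 _).
  apply: (@le_trans _ _ (\sum_(i < J) d i)); last first.
    by rewrite -mulr_sumr -[leRHS]mulr1 ler_wpM2l ?sum_halves // ltW.
  elim: J => [|J IHJ]; first by rewrite big_nil big_ord0.
  rewrite FS big_cat big_ord_recr /=; apply: lerD => //.
  by have [_ _ ws _] := sP J.
Qed.

(** * Countability of machines up to isomorphism *)

Definition alphabet_iso (G G' : alphabet) (c : G -> G') : Prop :=
  [/\ bijective c, c (blank G) = blank G' & forall b, c (bit G b) = bit G' b].

Section MapTape.
Variables (G G' : alphabet) (c : G -> G').
Hypothesis isoc : alphabet_iso c.

Definition map_tape (t : tape G) : tape G' := [fsfun i in finsupp t => c (t i) | blank G'].

Lemma alphabet_iso_inj : injective c. Proof. by case: isoc => /bij_inj. Qed.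

Lemma map_tapeE t i : map_tape t i = c (t i).
Proof.
rewrite fsfunE; case: ifPn => // ni; rewrite fsfun_dflt //.
by case: isoc.
Qed.

Lemma map_tape_inj : injective map_tape.
Proof.
move=> t t' /fsfunP e; apply/fsfunP => i; apply: alphabet_iso_inj.
by have := e i; rewrite !map_tapeE.
Qed.

Lemma map_tape_write t i g : map_tape (write_cell t i g) = write_cell (map_tape t) i (c g).
Proof.
apply/fsfunP => j; rewrite map_tapeE /write_cell !fsfun_withE map_tapeE.
by case: ifP.
Qed.

Lemma map_tape_input x : map_tape (input_tape G x) = input_tape G' x.
Proof.
have e0 : map_tape (empty_tape G) = empty_tape G'.
  by apply/fsfunP => j; rewrite map_tapeE /empty_tape !fsfunE; case: isoc.
rewrite /input_tape -e0; elim: x (0%N) (empty_tape G) => //= b x IHx i t.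
by rewrite IHx map_tape_write; case: isoc => _ _ ->.
Qed.

Lemma finsupp_map_tape t : finsupp (map_tape t) = finsupp t.
Proof.
apply/fsetP => i; rewrite !mem_finsupp map_tapeE; case: isoc => _ <- _.
by rewrite (inj_eq alphabet_iso_inj).
Qed.

Lemma decode_sym_iso g : decode_sym (c g) = decode_sym g.
Proof. by rewrite /decode_sym; case: isoc => _ _ <-; rewrite !(inj_eq alphabet_iso_inj); case: isoc => _ _ <-; rewrite (inj_eq alphabet_iso_inj). Qed.

Lemma tape_bits_map t : tape_bits (map_tape t) = tape_bits t.
Proof.
rewrite /tape_bits finsupp_map_tape.
elim: (size _).+1 (Posz 0) => //= f IHf i.
by rewrite map_tapeE decode_sym_iso; case: (decode_sym _) => // b; rewrite IHf.
Qed.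

End MapTape.

Definition map_move (Q Q' G G' : Type) (s : Q -> Q') (c : G -> G')
    (r : Q * G * G * dir * dir) : Q' * G' * G' * dir * dir :=
  let: (q, g1, g2, d1, d2) := r in (s q, c g1, c g2, d1, d2).

Definition map_cfg (Q Q' : finType) (G G' : alphabet) (s : Q -> Q') (c : G -> G')
    (k : cfg Q G) : cfg Q' G' :=
  let: (q, t1, h1, t2, h2) := k in (s q, map_tape c t1, h1, map_tape c t2, h2).

Section MapCfg.
Variables (Q Q' : finType) (G G' : alphabet) (s : Q -> Q') (c : G -> G').
Hypotheses (bijs : bijective s) (isoc : alphabet_iso c).

Lemma map_cfg_inj : injective (map_cfg s c).
Proof.
move=> [[[[q t1] h1] t2] h2] [[[[q' t1'] h1'] t2'] h2'] /= [].
by move=> /(bij_inj bijs) -> /(map_tape_inj isoc) -> -> /(map_tape_inj isoc) -> ->.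
Qed.

Lemma map_cfg_move k r : map_cfg s c (apply_move k r) = apply_move (map_cfg s c k) (map_move s c r).
Proof.
case: k => [[[[q t1] h1] t2] h2]; case: r => [[[[q' g1] g2] d1] d2] /=.
by rewrite !map_tape_write.
Qed.

Lemma map_cfg_init q x : map_cfg s c (init_cfg q x) = init_cfg (s q) x.
Proof.
rewrite /init_cfg /= map_tape_input //.
by rewrite -[empty_tape G]/(input_tape G [::]) map_tape_input.
Qed.

Lemma read_work_map k : read_work (map_cfg s c k) = c (read_work k).
Proof. by case: k => [[[[q t1] h1] t2] h2] /=; rewrite map_tapeE. Qed.

Lemma read_query_map k : read_query (map_cfg s c k) = c (read_query k).
Proof. by case: k => [[[[q t1] h1] t2] h2] /=; rewrite map_tapeE. Qed.

Lemma cfg_state_map k : cfg_state (map_cfg s c k) = s (cfg_state k).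
Proof. by case: k => [[[[q t1] h1] t2] h2]. Qed.

Lemma cfg_work_map k : cfg_work (map_cfg s c k) = map_tape c (cfg_work k).
Proof. by case: k => [[[[q t1] h1] t2] h2]. Qed.

Lemma map_move_inj : injective (map_move s c).
Proof.
move=> [[[[q g1] g2] d1] d2] [[[[q' g1'] g2'] d1'] d2'] /= [].
by move=> /(bij_inj bijs) -> /(alphabet_iso_inj isoc) -> /(alphabet_iso_inj isoc) -> -> ->.
Qed.

Lemma map_move_surj r' : exists r, map_move s c r = r'.
Proof.
case: r' => [[[[q g1] g2] d1] d2]; case: bijs => s' _ sK; case: isoc => -[c' _ cK] _ _.
by exists (s' q, c' g1, c' g2, d1, d2); rewrite /= sK !cK.
Qed.

End MapCfg.

(** * Isomorphic machines compute the same real *)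

Definition ntm_iso (M M' : ntm) : Prop :=
  exists (s : n_state M -> n_state M') (c : n_alph M -> n_alph M'),
    [/\ bijective s, alphabet_iso c,
      forall q g1 g2, n_delta M' (s q) (c g1) (c g2) = map (map_move s c) (n_delta M q g1 g2)
    & [/\ s (n_start M) = n_start M', s (n_acc M) = n_acc M', s (n_rej M) = n_rej M',
          s (n_query M) = n_query M' & s (n_yes M) = n_yes M' /\ s (n_no M) = n_no M']].

Lemma ntm_reach_iso (M M' : ntm) O x : ntm_iso M M' ->
  exists2 f : ntm_cfg M -> ntm_cfg M', forall k, ntm_reach M' O x k = map f (ntm_reach M O x k) &
    forall k, (cfg_state k = n_acc M -> cfg_state (f k) = n_acc M') /\
      tape_bits (cfg_work (f k)) = tape_bits (cfg_work k).
Proof.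
case=> s [c [bijs isoc dE [e1 e2 e3 e4 [e5 e6]]]].
exists (map_cfg s c); last first.
  move=> k; rewrite cfg_state_map cfg_work_map; split; last exact: tape_bits_map.
  by move=> ->.
have stepE k : ntm_step M' O (map_cfg s c k) = map (map_cfg s c) (ntm_step M O k).
  case: k => [[[[q t1] h1] t2] h2] /=.
  rewrite -e2 -e3 -e4 !(inj_eq (bij_inj bijs)); case: ifP => // _; case: ifP => _ /=.
    by rewrite tape_bits_map // -e5 -e6; case: (O _).
  rewrite !map_tapeE // dE -!map_comp; apply: eq_map => r /=.
  by rewrite -[RHS]/(map_cfg s c (apply_move (q, t1, h1, t2, h2) r)) map_cfg_move.
elim=> [|k IHk]; first by rewrite /ntm_reach -e1 -(map_cfg_init s isoc).
rewrite /ntm_reach !iterS -!/(ntm_reach _ _ _ _) IHk map_flatten -!map_comp.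
by congr flatten; apply: eq_map => d /=; rewrite stepE.
Qed.

(** The output clause of [ptime_computable_real], which pins down the real [r]. *)
Definition computes (M : ntm) (r : R) : Prop :=
  deterministic M /\ forall n : nat, exists (k : nat) (c : ntm_cfg M),
    c \in ntm_reach M (fun _ => false) (nseq n true) k /\ cfg_state c = n_acc M /\
    Rle (Rabs (Rminus r (dyadic_of (tape_bits (cfg_work c)) n))) (Rinv (pow (IZR 2) n)).

Lemma deterministic_reach (M : ntm) O x k : deterministic M -> (size (ntm_reach M O x k) <= 1)%N.
Proof.
move=> det; elim: k => // k; rewrite /ntm_reach iterS -/(ntm_reach _ _ _ _).
case: (ntm_reach M O x k) => [|d [|]] //= _; rewrite cats0.
case: d => [[[[q t1] h1] t2] h2] /=; case: ifP => // _; case: ifP => // _.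
by rewrite size_map.
Qed.

(** A deterministic machine has at most one configuration at each time and an accepting one has no
    successor, so the output is well defined. *)
Lemma ntm_reach_accepted (M : ntm) O x k l c d : deterministic M ->
  c \in ntm_reach M O x k -> cfg_state c = n_acc M ->
  d \in ntm_reach M O x l -> cfg_state d = n_acc M -> c = d.
Proof.
move=> det; wlog kl : k l c d / (k <= l)%N.
  move=> W; case: (leqP k l) => [kl|/ltnW lk] h1 h2 h3 h4; first exact: (W k l).
  by apply/esym; apply: (W l k).
move=> ck cacc dl dacc.
have e : ntm_reach M O x k = [:: c].
  have := deterministic_reach O x k det; move: ck.
  by case: (ntm_reach M O x k) => [|a [|]] //; rewrite inE => /eqP ->.
have step0 : ntm_step M O c = [::].
  by move: cacc; case: (c) => [[[[q t1] h1] t2] h2] /= ->; rewrite eqxx.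
have reach0 j : ntm_reach M O x (k + j.+1) = [::].
  elim: j => [|j IHj]; first by rewrite addn1 /ntm_reach iterS -/(ntm_reach _ _ _ _) e /= step0.
  by rewrite addnS /ntm_reach iterS -/(ntm_reach _ _ _ _) IHj.
move: kl dl; rewrite leq_eqVlt => /orP[/eqP <-|kl]; first by rewrite e inE => /eqP ->.
by rewrite -(subnKC kl) addSnnS reach0.
Qed.

(** For every [n] both reals lie within [2 ^ -n] of the same dyadic number. *)
Lemma computes_unique (M M' : ntm) r r' : ntm_iso M M' -> computes M r -> computes M' r' -> r = r'.
Proof.
move=> iso [det cM] [det' cM'].
have close n : `|r - r'| <= 2 * (1 / 2) ^+ n.
  have [k [c [ck [cacc hc]]]] := cM n; have [k' [c' [ck' [cacc' hc']]]] := cM' n.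
  have [f fE facc] := ntm_reach_iso (fun _ => false) (nseq n true) iso.
  have [fa ft] := facc c.
  have ec : f c = c'.
    by apply: (ntm_reach_accepted det' _ (fa cacc) ck' cacc'); rewrite fE; apply: map_f; exact: ck.
  rewrite -ec ft in hc'; move: hc hc'; set v := dyadic_of _ _.
  rewrite -IZR2E => /RleP + /RleP; rewrite !RabsE !RminusE RinvE RpowE IZR2E.
  rewrite div1r exprVn; set p := (2 ^+ n)^-1 => h1 h2.
  have -> : r - r' = (r - v) - (r' - v) by ring.
  apply: le_trans (ler_normB _ _) _; lra.
apply/eqP; rewrite -subr_eq0 -normr_le0 leNgt; apply/negP => d0.
have [|||n hn] := @pow_small (1 / 2) (`|r - r'| / 4); try lra.
have := close n; lra.
Qed.

(** * Countable codes of classical and quantum machines *)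

Definition ntm_code_data (nm : nat * nat) : Type :=
  {ffun 'I_nm.1 * 'I_nm.2 * 'I_nm.2 -> seq ('I_nm.1 * 'I_nm.2 * 'I_nm.2 * dir * dir)} *
  ('I_nm.1 * 'I_nm.1 * 'I_nm.1 * 'I_nm.1 * 'I_nm.1 * 'I_nm.1) * ('I_nm.2 * 'I_nm.2 * 'I_nm.2).

HB.instance Definition _ nm := Countable.on (ntm_code_data nm).

Definition ntm_code : Type := {nm : nat * nat & ntm_code_data nm}.

HB.instance Definition _ := Countable.on ntm_code.

(* States and symbols are named by ordinals; the code of an alphabet lists its
   blank symbol, the bit [false] and the bit [true]. *)
Definition alphabet_coded m (G : alphabet) (c : G -> 'I_m) (bs : 'I_m * 'I_m * 'I_m) : Prop :=
  [/\ bijective c, c (blank G) = bs.1.1 & forall b, c (bit G b) = if b then bs.2 else bs.1.2].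

Definition ntm_coded (e : ntm_code) (M : ntm) : Prop :=
  exists (s : n_state M -> 'I_(tag e).1) (c : n_alph M -> 'I_(tag e).2),
    [/\ bijective s, alphabet_coded c (tagged e).2,
      forall q g1 g2, (tagged e).1.1 (s q, c g1, c g2) = map (map_move s c) (n_delta M q g1 g2)
    & (s (n_start M), s (n_acc M), s (n_rej M), s (n_query M), s (n_yes M), s (n_no M))
        = (tagged e).1.2].

Lemma ntm_codeP M : exists e, ntm_coded e M.
Proof.
pose s := @enum_rank (n_state M); pose c := @enum_rank (n_alph M).
pose d : ntm_code_data (#|n_state M|, #|n_alph M|) :=
  ([ffun k => map (map_move s c) (n_delta M (enum_val k.1.1) (enum_val k.1.2) (enum_val k.2))],
   (s (n_start M), s (n_acc M), s (n_rej M), s (n_query M), s (n_yes M), s (n_no M)),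
   (c (blank _), c (bit _ false), c (bit _ true))).
exists (Tagged ntm_code_data d), s, c; split=> //=.
- exact: enum_rank_bij.
- by split=> //=; [exact: enum_rank_bij | case].
- by move=> q g1 g2; rewrite ffunE /= !enum_rankK.
Qed.

Lemma alphabet_coded_iso m (G G' : alphabet) (c : G -> 'I_m) (c' : G' -> 'I_m) bs :
  alphabet_coded c bs -> alphabet_coded c' bs ->
  exists2 c0 : G -> G', alphabet_iso c0 & forall g, c' (c0 g) = c g.
Proof.
move=> [bc cb ct] [bc' cb' ct']; case: (bc') => d c'K dK; exists (d \o c) => [|g /=].
  split=> /=; first by apply: bij_comp => //; exists c'.
    by rewrite cb -cb' c'K.
  by move=> b; rewrite ct -ct' c'K.
by rewrite dK.
Qed.

Lemma state_coded_iso n (Q Q' : finType) (s : Q -> 'I_n) (s' : Q' -> 'I_n) :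
  bijective s -> bijective s' ->
  exists2 s0 : Q -> Q', bijective s0 & forall q, s' (s0 q) = s q.
Proof.
move=> bs bs'; case: (bs') => d s'K dK; exists (d \o s) => [|q /=]; last by rewrite dK.
by apply: bij_comp => //; exists s'.
Qed.

Lemma map_move_comp (Q Q' Q'' G G' G'' : Type) (s' : Q' -> Q'') (c' : G' -> G'') (s : Q -> Q')
    (c : G -> G') (s2 : Q -> Q'') (c2 : G -> G'') r :
  (forall q, s' (s q) = s2 q) -> (forall g, c' (c g) = c2 g) ->
  map_move s' c' (map_move s c r) = map_move s2 c2 r.
Proof. by move=> es ec; case: r => [[[[q g1] g2] d1] d2] /=; rewrite es !ec. Qed.

Lemma ntm_coded_iso e (M M' : ntm) : ntm_coded e M -> ntm_coded e M' -> ntm_iso M M'.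
Proof.
case: e => nm d; move=> [s [c [bs cc dE tE]]] [s' [c' [bs' cc' dE' tE']]].
have [s0 bs0 s0E] := state_coded_iso bs bs'; have [c0 ic0 c0E] := alphabet_coded_iso cc cc'.
have inj' := bij_inj bs'; have cinj' : injective c' by case: cc' => /bij_inj.
exists s0, c0; split=> //.
  move=> q g1 g2.
  have mi : injective (map_move s' c').
    move=> [[[[q1 g3] g4] d1] d2] [[[[q1' g3'] g4'] d1'] d2'] /= [].
    by move=> /inj' -> /cinj' -> /cinj' -> -> ->.
  apply: (inj_map mi); rewrite -dE' s0E !c0E dE -map_comp; apply: eq_map => r /=.
  by apply/esym/map_move_comp.
move: tE; rewrite -tE' => -[e1 e2 e3 e4 e5 e6].
by split; try split; apply: inj'; rewrite s0E.
Qed.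

Definition real_coded (e : ntm_code) (r : R) := exists2 M, ntm_coded e M & computes M r.

(** A code fixes the machine up to isomorphism, hence also the real it computes. *)
Lemma real_coded_unique e r r' : real_coded e r -> real_coded e r' -> r = r'.
Proof. by move=> [M eM cM] [M' eM' cM']; apply: computes_unique (ntm_coded_iso eM eM') cM cM'. Qed.

Lemma real_codeP r : ptime_computable_real r -> exists e, real_coded e r.
Proof.
move=> [M [d [det h]]]; have [e eM] := ntm_codeP M; exists e, M => //; split=> // n.
by have [_] := h n.
Qed.

(* An amplitude is coded by codes of machines computing its two components. *)
Definition qtm_code_data (nm : nat * nat) : Type :=
  {ffun 'I_nm.1 * 'I_nm.2 * 'I_nm.2 * ('I_nm.1 * 'I_nm.2 * 'I_nm.2 * dir * dir) ->
    ntm_code * ntm_code} *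
  ('I_nm.1 * 'I_nm.1 * 'I_nm.1 * 'I_nm.1) * ('I_nm.2 * 'I_nm.2 * 'I_nm.2).

HB.instance Definition _ nm := Countable.on (qtm_code_data nm).

Definition qtm_code : Type := {nm : nat * nat & qtm_code_data nm}.

HB.instance Definition _ := Countable.on qtm_code.

Definition qtm_coded (e : qtm_code) (M : qtm) : Prop :=
  exists (s : q_state M -> 'I_(tag e).1) (c : q_alph M -> 'I_(tag e).2),
    [/\ bijective s, alphabet_coded c (tagged e).2,
      forall q g1 g2 r, let a := (tagged e).1.1 (s q, c g1, c g2, map_move s c r) in
        real_coded a.1 (q_delta M q g1 g2 r).1 /\ real_coded a.2 (q_delta M q g1 g2 r).2
    & (s (q_start M), s (q_final M), s (q_pre M), s (q_post M)) = (tagged e).1.2].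

Lemma qtm_codeP M : amplitudes_ptime M -> exists e, qtm_coded e M.
Proof.
move=> ptM; pose s := @enum_rank (q_state M); pose c := @enum_rank (q_alph M).
pose s' := @enum_val (q_state M) predT; pose c' := @enum_val (q_alph M) predT.
pose e1 q g1 g2 r := sval (cid (real_codeP (ptM q g1 g2 r).1)).
pose e2 q g1 g2 r := sval (cid (real_codeP (ptM q g1 g2 r).2)).
pose d : qtm_code_data (#|q_state M|, #|q_alph M|) :=
  ([ffun k => let r := map_move s' c' k.2 in
      (e1 (s' k.1.1.1) (c' k.1.1.2) (c' k.1.2) r, e2 (s' k.1.1.1) (c' k.1.1.2) (c' k.1.2) r)],
   (s (q_start M), s (q_final M), s (q_pre M), s (q_post M)),
   (c (blank _), c (bit _ false), c (bit _ true))).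
exists (Tagged qtm_code_data d), s, c; split=> //=.
- exact: enum_rank_bij.
- by split=> //=; [exact: enum_rank_bij | case].
- move=> q g1 g2 r; rewrite ffunE /= /s' /c' !enum_rankK.
  have -> : map_move (@enum_val _ predT) (@enum_val _ predT) (map_move s c r) = r.
    by case: r => [[[[q' g1'] g2'] d1] d2] /=; rewrite !enum_rankK.
  by split; [apply: svalP (cid (real_codeP _)) | apply: svalP (cid (real_codeP _))].
Qed.

Definition qtm_iso (M M' : qtm) : Prop :=
  exists (s : q_state M -> q_state M') (c : q_alph M -> q_alph M'),
    [/\ bijective s, alphabet_iso c,
      forall q g1 g2 r, q_delta M' (s q) (c g1) (c g2) (map_move s c r) = q_delta M q g1 g2 r
    & [/\ s (q_start M) = q_start M', s (q_final M) = q_final M',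
          s (q_pre M) = q_pre M' & s (q_post M) = q_post M']].

(** States and symbols are matched through their common names; corresponding amplitudes agree
    because a code names at most one real. *)
Lemma qtm_coded_iso e (M M' : qtm) : qtm_coded e M -> qtm_coded e M' -> qtm_iso M M'.
Proof.
case: e => nm d; move=> [s [c [bs cc dE tE]]] [s' [c' [bs' cc' dE' tE']]].
have [s0 bs0 s0E] := state_coded_iso bs bs'; have [c0 ic0 c0E] := alphabet_coded_iso cc cc'.
have inj' := bij_inj bs'; exists s0, c0; split=> //.
  move=> q g1 g2 r; have := dE' (s0 q) (c0 g1) (c0 g2) (map_move s0 c0 r).
  rewrite s0E !c0E (map_move_comp _ s0E c0E) /= => -[h1 h2]; have [h3 h4] := dE q g1 g2 r.
  by apply: cpx_eq; [apply: real_coded_unique h1 h3 | apply: real_coded_unique h2 h4].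
move: tE; rewrite -tE' => -[e1 e2 e3 e4].
by split; apply: inj'; rewrite s0E.
Qed.

(** * Invariance of quantum runs under isomorphism *)

Section RunIso.
Variables (M M' : qtm) (s : q_state M -> q_state M') (c : q_alph M -> q_alph M').
Hypotheses (bs : bijective s) (ic : alphabet_iso c).
Hypothesis dE : forall q g1 g2 r,
  q_delta M' (s q) (c g1) (c g2) (map_move s c r) = q_delta M q g1 g2 r.
Hypotheses (start_iso : s (q_start M) = q_start M') (final_iso : s (q_final M) = q_final M').
Hypotheses (pre_iso : s (q_pre M) = q_pre M') (post_iso : s (q_post M) = q_post M').

Let f : qtm_cfg M -> qtm_cfg M' := map_cfg s c.
Let f_inj : injective f := map_cfg_inj bs ic.

Lemma q_oracle_apply_iso O k : q_oracle_apply M' O (f k) = f (q_oracle_apply M O k).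
Proof.
case: k => [[[[q t1] h1] t2] h2]; rewrite /f /= tape_bits_map // -post_iso.
case: (tape_bits t2) => [|b l] //=.
by rewrite map_tape_write //; case: ic => _ _ ->.
Qed.

Lemma qmoves_iso : perm_eq (map (map_move s c) (qmoves M)) (qmoves M').
Proof.
have injm := map_move_inj bs ic; apply: uniq_perm; try exact: enum_uniq.
  by rewrite (map_inj_uniq injm) enum_uniq.
move=> r'; rewrite mem_enum inE; have [r <-] := map_move_surj bs ic r'.
by rewrite map_f // mem_enum.
Qed.

Lemma perm_csum (T : eqType) (l l' : seq T) (g : T -> cpx) : perm_eq l l' -> csum l g = csum l' g.
Proof. by move=> pl; apply: cpx_eq; rewrite ?csum1 ?csum2; apply: perm_big. Qed.

Lemma csum_map (T T' : Type) (h : T -> T') (l : seq T) (g : T' -> cpx) :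
  csum (map h l) g = csum l (fun a => g (h a)).
Proof. by apply: cpx_eq; rewrite ?csum1 ?csum2 big_map. Qed.

Lemma q_step_amp_iso O k k' : q_step_amp M' O (f k) (f k') = q_step_amp M O k k'.
Proof.
rewrite /q_step_amp /f cfg_state_map -pre_iso (inj_eq (bij_inj bs)) -/f.
rewrite q_oracle_apply_iso (inj_eq f_inj); case: ifP => // _.
rewrite -(perm_csum _ qmoves_iso) csum_map; apply: eq_csum => r _.
by rewrite /f -map_cfg_move // (inj_eq f_inj) read_work_map // read_query_map // dE.
Qed.

Lemma q_succs_iso O k k' : (k' \in q_succs M' O (f k)) = (k' \in map f (q_succs M O k)).
Proof.
rewrite /q_succs /f cfg_state_map -pre_iso (inj_eq (bij_inj bs)) -/f.
case: ifP => _; first by rewrite q_oracle_apply_iso.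
transitivity (k' \in map (apply_move (f k)) (map (map_move s c) (qmoves M))).
  exact/esym/(perm_mem (perm_map _ qmoves_iso)).
rewrite -!map_comp; congr (k' \in _); apply: eq_map => r /=.
by rewrite /f map_cfg_move.
Qed.

(** The supports correspond only up to order, since the moves of the two machines are enumerated in
    unrelated orders. *)
Lemma q_run_iso O y t : perm_eq (q_run M' O y t).1 (map f (q_run M O y t).1) /\
  forall k, (q_run M' O y t).2 (f k) = (q_run M O y t).2 k.
Proof.
elim: t => [|t [IH1 IH2]].
  have e : init_cfg (q_start M') y = f (init_cfg (q_start M) y).
    by rewrite /f map_cfg_init // start_iso.
  by rewrite /q_run /= e; split=> // k; rewrite (inj_eq f_inj).
rewrite /q_run !iterS -!/(q_run _ _ _ _) /evolve /=; split.
  apply: uniq_perm; rewrite ?undup_uniq // ?map_inj_uniq ?undup_uniq //.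
  move=> k'; rewrite mem_undup; apply/flattenP/mapP.
    move=> [l /mapP [d' + ->]]; rewrite (perm_mem IH1) => /mapP [d din ->].
    rewrite q_succs_iso => /mapP [k kin ->]; exists k => //; rewrite mem_undup.
    by apply/flattenP; exists (q_succs M O d) => //; apply: map_f.
  move=> [k + ->]; rewrite mem_undup => /flattenP [l /mapP [d din ->] kin].
  exists (q_succs M' O (f d)); last by rewrite q_succs_iso map_f.
  by apply: map_f; rewrite (perm_mem IH1) map_f.
move=> k; rewrite (perm_csum _ IH1) csum_map; apply: eq_csum => d _.
by rewrite IH2 q_step_amp_iso.
Qed.

Lemma accepting_iso k : accepting (f k) = accepting k.
Proof.
rewrite /accepting /f cfg_work_map map_tapeE //; case: (ic) => _ _ <-.
by rewrite (inj_eq (alphabet_iso_inj ic)).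
Qed.

Lemma decides_run_iso A y tm b : decides M A y tm b -> decides M' A y tm b.
Proof.
move=> [t [ttm [[h1 h2] [acc rej]]]]; exists t; split; first exact: ttm.
set O := bool_oracle A in h1 h2 acc rej *.
split; first split.
- move=> k'; have [e1 e2] := q_run_iso O y t; rewrite (perm_mem e1) => /mapP [k kin ->].
  by rewrite e2 => /(h1 k kin) kf; rewrite /f cfg_state_map kf.
- move=> u ut k'; have [e1 e2] := q_run_iso O y u; rewrite (perm_mem e1) => /mapP [k kin ->].
  rewrite e2 => /(h2 u ut k kin) kf; rewrite /f cfg_state_map -final_iso.
  by move=> /(bij_inj bs).
have [e1 e2] := q_run_iso O y t.
have -> : acc_prob M' O y t = acc_prob M O y t.
  rewrite /acc_prob !rsumE (perm_big _ e1) big_map; apply: eq_bigr => k _.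
  by rewrite -/(accepting _) accepting_iso e2.
have -> : rej_prob M' O y t = rej_prob M O y t.
  rewrite /rej_prob !rsumE (perm_big _ e1) big_map; apply: eq_bigr => k _.
  by rewrite -/(accepting _) accepting_iso e2.
by split.
Qed.

End RunIso.

Lemma decides_iso (M M' : qtm) A y tm b : qtm_iso M M' -> decides M A y tm b -> decides M' A y tm b.
Proof. by case=> s [c [bs ic dE [e1 e2 e3 e4]]]; apply: (decides_run_iso bs ic dE). Qed.

(** The oracles are split according to the code of a successful machine, which makes a countable
    union. *)
Lemma BQTime_lang_null (T : nat -> nat) : little_o_2pow_third T ->
  perm_null (fun A => BQTime_rel T A (lang A)).
Proof.
move=> oT; pose N (i : nat) A := exists M, exists2 e : qtm_code, choice.unpickle i = Some e &
  [/\ qtm_coded e M, well_formed M & decides_all M T A].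
have cN i : finitely_coverable (N i).
  case E: (choice.unpickle i : option qtm_code) => [e|]; last first.
    move=> x x0; exists [::]; split=> //; last by rewrite big_nil ltW.
    by move=> A _ [M [e]]; rewrite E.
  have [[M0 [eM0 wf0]]|no] := pselect (exists M, qtm_coded e M /\ well_formed M); last first.
    move=> x x0; exists [::]; split=> //; last by rewrite big_nil ltW.
    by move=> A _ [M [e']]; rewrite E => -[<-] [h1 h2 _]; case: no; exists M.
  (* Every machine with this code is isomorphic to [M0], so one cover made for [M0] serves them
     all. *)
  move=> x x0; have [l [pl cl wl]] := decides_all_coverable wf0 oT x0.
  exists l; split=> // A pA [M [e']]; rewrite E => -[<-] [eM _ dM]; apply: cl => // y.
  exact: decides_iso (qtm_coded_iso eM eM0) (dM y).
move=> x x0; have [B [K [pB [cB wB]]]] := countable_union_null cN x0.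
exists B, K; split=> //; split=> // A pA [M [wM [aM dM]]]; apply: cB => //.
have [e eM] := qtm_codeP aM; exists (choice.pickle e), M, e; first exact: choice.pickleK.
by split=> // y; apply: dM.
Qed.

(** * The search machine *)

Lemma bit_alphabet_nblank (b : bool) : Some b != None. Proof. by []. Qed.

Lemma bit_alphabet_inj : injective (@Some bool). Proof. by move=> b b' []. Qed.

Definition bit_alphabet : alphabet :=
  @Alphabet (option bool) None Some bit_alphabet_inj bit_alphabet_nblank.

Local Notation string_tape := (input_tape bit_alphabet).

Lemma write_bitsE (t : tape bit_alphabet) i x j :
  write_bits t i x (Posz j) =
    if (i <= j < i + size x)%N then nth None (map Some x) (j - i) else t (Posz j).
Proof.
elim: x i t => [|b x IHx] i t /=; first by rewrite addn0; case: ltngtP.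
rewrite IHx /write_cell fsfun_withE eqz_nat addSnnS.
case: (ltngtP i j) => [ij|ji|->] /=.
- by rewrite -(subnSK ij).
- by [].
- by rewrite subnn addnS ltnS leq_addr.
Qed.

Lemma write_bits_neg (t : tape bit_alphabet) i x j : write_bits t i x (Negz j) = t (Negz j).
Proof. by elim: x i t => //= b x IHx i t; rewrite IHx /write_cell fsfun_withE. Qed.

Lemma string_tapeE s j : string_tape s (Posz j) = nth None (map Some s) j.
Proof.
rewrite /input_tape write_bitsE /= add0n subn0; case: ltnP => // sj.
by rewrite nth_default ?size_map // /empty_tape fsfunE.
Qed.

Lemma string_tape_neg s j : string_tape s (Negz j) = None.
Proof. by rewrite /input_tape write_bits_neg /empty_tape fsfunE. Qed.

(** [behead v] treats two cases at once: overwriting the first bit of [v], and appending when [v] is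
    empty. *)
Lemma write_string_tape u v b :
  write_cell (string_tape (u ++ v)) (Posz (size u)) (Some b) = string_tape (u ++ b :: behead v).
Proof.
apply/fsfunP => -[j|j]; rewrite /write_cell fsfun_withE ?string_tape_neg // !string_tapeE.
rewrite eqz_nat !map_cat !nth_cat !size_map; case: (ltngtP j (size u)) => // [uj|->].
  by rewrite -(subnSK uj) /= -behead_map nth_behead.
by rewrite subnn.
Qed.

Lemma write_cell_id (G : alphabet) (t : tape G) i : write_cell t i (t i) = t.
Proof. by apply/fsfunP => j; rewrite /write_cell fsfun_withE; case: eqP => // ->. Qed.

Lemma size_finsupp_string_tape s : (size s <= size (finsupp (string_tape s)))%N.
Proof.
rewrite -(size_iota 0 (size s)) -(size_map Posz); apply: uniq_leq_size.
  by rewrite map_inj_uniq ?iota_uniq // => i j [].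
move=> _ /mapP [i + ->]; rewrite mem_iota /= add0n => ik.
by rewrite mem_finsupp string_tapeE (nth_map false).
Qed.

Lemma tape_bits_string s : tape_bits (string_tape s) = s.
Proof.
(* Generalised to reading from cell [i] with fuel above [size s - i], which yields [drop i s]. *)
rewrite /tape_bits; have : (size s - 0 < (size (finsupp (string_tape s))).+1)%N.
  by rewrite subn0 ltnS size_finsupp_string_tape.
rewrite -[RHS]drop0; elim: _.+1 (0%N) => //= f IHf i.
rewrite ltnS string_tapeE => sf; case: (ltnP i (size s)) => [lt|le]; last first.
  by rewrite nth_default ?size_map // drop_oversize.
rewrite (nth_map false) // (drop_nth false lt).
have -> : decode_sym (Some (nth false s i) : bit_alphabet) = Some (nth false s i).
  by case: (nth false s i).
by rewrite -[GRing.add _ _]/(Posz (i + 1)) addn1 IHf //; lia.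
Qed.

(** * Running time and acceptance of nondeterministic runs *)

Section Outcome.
Variables (M : ntm) (O : seq bool -> bool).
Hypothesis acc_rej : n_acc M != n_rej M.

Definition nrun k (l : seq (ntm_cfg M)) := iter k (fun s => flatten (map (ntm_step M O) s)) l.

(** Time bound and acceptance condition are kept together, so that one backward induction along the
    computation proves both. *)
Definition outcome (c : ntm_cfg M) t (P : Prop) : Prop :=
  nrun t.+1 [:: c] = [::] /\
  ((exists k, has (fun c => cfg_state c == n_acc M) (nrun k [:: c])) <-> P).

Lemma nrun_cat k l1 l2 : nrun k (l1 ++ l2) = nrun k l1 ++ nrun k l2.
Proof. by elim: k => // k IHk; rewrite /nrun !iterS -!/(nrun _ _) IHk map_cat flatten_cat. Qed.

Lemma nrun_nil k : nrun k [::] = [::].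
Proof. by elim: k => // k IHk; rewrite /nrun !iterS -!/(nrun _ _) IHk. Qed.

Lemma nrunS k c : nrun k.+1 [:: c] = nrun k (ntm_step M O c).
Proof. by rewrite /nrun iterSr /= cats0. Qed.

Lemma outcome_mono c t t' P : (t <= t')%N -> outcome c t P -> outcome c t' P.
Proof.
move=> tt' [h1 h2]; split=> //; rewrite -(subnK tt') -addnS.
by rewrite /nrun iterD -!/(nrun _ _) h1 nrun_nil.
Qed.

Lemma outcome_iff c t (P Q : Prop) : (P <-> Q) -> outcome c t P -> outcome c t Q.
Proof. by move=> PQ [h1 h2]; split=> //; rewrite h2. Qed.

Lemma outcome_acc c t : cfg_state c = n_acc M -> outcome c t True.
Proof.
move=> cacc; split; last by split=> // _; exists 0%N; rewrite /= cacc eqxx.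
rewrite nrunS; have -> : ntm_step M O c = [::]; last exact: nrun_nil.
by move: cacc; case: (c) => [[[[q t1] h1] t2] h2] /= ->; rewrite eqxx.
Qed.

Lemma outcome_rej c t : cfg_state c = n_rej M -> outcome c t False.
Proof.
move=> crej; have s0 : ntm_step M O c = [::].
  by move: crej; case: (c) => [[[[q t1] h1] t2] h2] /= ->; rewrite eqxx orbT.
split; first by rewrite nrunS s0 nrun_nil.
split=> // -[[|k]]; first by rewrite /= crej eq_sym (negPf acc_rej).
by rewrite nrunS s0 nrun_nil.
Qed.

Lemma outcome_step1 c c' t P : cfg_state c != n_acc M -> ntm_step M O c = [:: c'] ->
  outcome c' t P -> outcome c t.+1 P.
Proof.
move=> nacc sE [h1 h2]; split; first by rewrite nrunS sE h1.
rewrite -h2; split=> [[[|k]]|[k hk]].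
- by rewrite /= (negPf nacc).
- by rewrite nrunS sE => hk; exists k.
- by exists k.+1; rewrite nrunS sE.
Qed.

Lemma outcome_step2 c c1 c2 t P1 P2 : cfg_state c != n_acc M -> ntm_step M O c = [:: c1; c2] ->
  outcome c1 t P1 -> outcome c2 t P2 -> outcome c t.+1 (P1 \/ P2).
Proof.
move=> nacc sE [h1 h2] [h3 h4].
have sE' k : nrun k.+1 [:: c] = nrun k [:: c1] ++ nrun k [:: c2].
  by rewrite nrunS sE -[[:: c1; c2]]/([:: c1] ++ [:: c2]) nrun_cat.
split; first by rewrite sE' h1 h3.
rewrite -h2 -h4; split=> [[[|k]]|[[k hk]|[k hk]]].
- by rewrite /= (negPf nacc).
- by rewrite sE' has_cat => /orP [hk|hk]; [left|right]; exists k.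
- by exists k.+1; rewrite sE' has_cat hk.
- by exists k.+1; rewrite sE' has_cat hk orbT.
Qed.

End Outcome.

(** The argument of [Insert] is the displaced bit that has to be written into the next cell. *)
Inductive phase := Guess | Rewind | Insert of bool | Return | Query | Check | Final | Accept | Reject.

Definition phase_code (p : phase) : 'I_10 :=
  match p with
  | Guess => @Ordinal 10 0 isT | Rewind => @Ordinal 10 1 isT
  | Insert false => @Ordinal 10 2 isT | Insert true => @Ordinal 10 3 isT
  | Return => @Ordinal 10 4 isT | Query => @Ordinal 10 5 isT | Check => @Ordinal 10 6 isT
  | Final => @Ordinal 10 7 isT | Accept => @Ordinal 10 8 isT | Reject => @Ordinal 10 9 isT
  end.

Definition phase_decode (i : 'I_10) : phase :=
  match nat_of_ord i with
  | 0 => Guess | 1 => Rewind | 2 => Insert false | 3 => Insert true | 4 => Return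
  | 5 => Query | 6 => Check | 7 => Final | 8 => Accept | _ => Reject
  end%N.

Lemma phase_codeK : cancel phase_code phase_decode.
Proof. by case=> // -[]. Qed.

HB.instance Definition _ := Equality.copy phase (can_type phase_codeK).
HB.instance Definition _ := Choice.copy phase (can_type phase_codeK).
HB.instance Definition _ := Countable.copy phase (can_type phase_codeK).
HB.instance Definition _ := Finite.copy phase (can_type phase_codeK).

(* Both heads always move together.  The machine guesses a string [x] as long as
   the input on the query tape and inserts a [0] in front of it; whenever the
   query [1^i 0 x] is answered positively it inserts a further [1].  At the first
   negative answer it accepts iff the [0] lies just beyond the input (so [i] is the
   input length) and [x] starts with the bit [b0]. *)
Definition search_delta (b0 : bool) (q : phase) (w g : bit_alphabet) :
    seq (phase * bit_alphabet * bit_alphabet * dir * dir) :=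
  match q, w, g with
  | Guess, Some _, _ => [:: (Guess, w, Some false, true, true); (Guess, w, Some true, true, true)]
  | Guess, None, _ => [:: (Rewind, w, g, false, false)]
  | Rewind, _, Some _ => [:: (Rewind, w, g, false, false)]
  | Rewind, _, None => [:: (Insert false, w, g, true, true)]
  | Insert b, _, Some b' => [:: (Insert b', w, Some b, true, true)]
  | Insert b, _, None => [:: (Return, w, Some b, false, false)]
  | Return, _, Some _ => [:: (Return, w, g, false, false)]
  | Return, _, None => [:: (Query, w, g, true, true)]
  | Check, _, Some true => [:: (Check, w, g, true, true)]
  | Check, None, Some false => [:: (Final, w, g, true, true)]
  | Check, Some _, Some false => [:: (Reject, w, g, true, true)]
  | Final, _, _ => [:: (if odflt false g == b0 then Accept else Reject, w, g, true, true)]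
  | _, _, _ => [::]
  end.

Definition search_ntm (b0 : bool) : ntm :=
  @NTM phase bit_alphabet (search_delta b0) Guess Accept Reject Query (Insert true) Check.

(** * Correctness of the search machine *)

Section Search.
Variables (b0 : bool) (A : seq bool -> seq bool) (w : seq bool).

Local Notation M := (search_ntm b0).
Local Notation O := (bool_oracle A).
Local Notation n := (size w).

(** The work tape always holds the input and the heads share a position, so phase, query string and
    position describe every configuration that occurs. *)
Definition at_head (q : phase) (s : seq bool) (h : int) : ntm_cfg M :=
  (q, string_tape w, h, string_tape s, h).

Local Notation out := (@outcome M O).
Local Notation left_of j := (move_head (Posz j) false).

Lemma left_ofS j : left_of j.+1 = Posz j.
Proof. by rewrite /move_head NegzE; lia. Qed.

Lemma right_of j : move_head (Posz j) true = Posz j.+1.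
Proof. by rewrite /move_head -[GRing.add _ _]/(Posz (j + 1)) addn1. Qed.

Lemma search_step q s h : q != Accept -> q != Reject -> q != Query ->
  ntm_step M O (at_head q s h) =
  map (apply_move (at_head q s h)) (search_delta b0 q (string_tape w h) (string_tape s h)).
Proof. by move=> /negPf qa /negPf qr /negPf qq; rewrite /= qa qr qq. Qed.

Lemma search_step_keep q q' s h d : q != Accept -> q != Reject -> q != Query ->
  search_delta b0 q (string_tape w h) (string_tape s h) =
    [:: (q', string_tape w h, string_tape s h, d, d)] ->
  ntm_step M O (at_head q s h) = [:: at_head q' s (move_head h d)].
Proof.
move=> qa qr qq dE; rewrite search_step // dE.
by rewrite -[LHS]/[:: apply_move _ _] /apply_move /at_head !write_cell_id.
Qed.

Lemma apply_move_write q q' u v b d :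
  apply_move (at_head q (u ++ v) (Posz (size u)))
    (q', string_tape w (Posz (size u)), Some b, d, d) =
  at_head q' (u ++ b :: behead v) (move_head (Posz (size u)) d).
Proof. by rewrite /apply_move /at_head write_cell_id write_string_tape. Qed.

(** Shared by [Rewind] and [Return]: [j] steps left over bits to the blank cell -1, and one step
    back to cell 0. *)
Lemma outcome_rewind q q' s t P j :
  q != Accept -> q != Reject -> q != Query ->
  (forall x b, search_delta b0 q x (Some b) = [:: (q, x, Some b, false, false)]) ->
  (forall x, search_delta b0 q x None = [:: (q', x, None, true, true)]) ->
  (j <= size s)%N ->
  out (at_head q' s (Posz 0)) t P -> out (at_head q s (left_of j)) (t + j.+1) P.
Proof.
move=> qa qr qq dS dN; elim: j => [|j IHj] js hP.
  rewrite addn1; apply: outcome_step1 hP => //.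
  have e : string_tape s (left_of 0) = None by rewrite string_tape_neg.
  by rewrite (@search_step_keep _ q' _ _ true) // e dN.
rewrite addnS; apply: outcome_step1 (IHj (ltnW js) hP) => //.
rewrite left_ofS; have e : string_tape s (Posz j) = Some (nth false s j).
  by rewrite string_tapeE (nth_map false).
by rewrite (@search_step_keep _ q _ _ false) // e dS.
Qed.

Lemma Insert_neq b : [/\ Insert b != Accept, Insert b != Reject & Insert b != Query].
Proof. by case: b. Qed.

Lemma outcome_insert u v b t P :
  out (at_head Return (u ++ b :: v) (left_of (size u + size v))) t P ->
  out (at_head (Insert b) (u ++ v) (Posz (size u))) (t + (size v).+1) P.
Proof.
elim: v u b => [|b' v IHv] u b; have [ia ir iq] := Insert_neq b.
  rewrite addn0 addn1 => hP; apply: outcome_step1 hP => //.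
  have e : string_tape (u ++ [::]) (Posz (size u)) = None.
    by rewrite cats0 string_tapeE nth_default ?size_map.
  by rewrite search_step // e -[LHS]/[:: apply_move _ _] apply_move_write.
rewrite /= [(t + _.+1)%N]addnS => hP; apply: (@outcome_step1 _ _ _ (at_head (Insert b') (rcons u b ++ v) (Posz (size (rcons u b))))) => //.
  have e : string_tape (u ++ b' :: v) (Posz (size u)) = Some b'.
    by rewrite string_tapeE (nth_map false) ?size_cat ?addnS ?ltnS ?leq_addr // nth_cat ltnn subnn.
  rewrite search_step // e -[LHS]/[:: apply_move _ _] apply_move_write right_of size_rcons.
  by rewrite cat_rcons.
by apply: IHv; rewrite cat_rcons size_rcons addSnnS.
Qed.

Lemma outcome_insert_round s b t P :
  out (at_head Query (b :: s) (Posz 0)) t P ->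
  out (at_head (Insert b) s (Posz 0)) (t + (size s).+1 + (size s).+1) P.
Proof.
move=> hP; apply: (@outcome_insert [::] s); rewrite add0n.
by apply: outcome_rewind hP => //=.
Qed.

Lemma outcome_query s t P :
  out (at_head (if O s then Insert true else Check) s (Posz 0)) t P ->
  out (at_head Query s (Posz 0)) t.+1 P.
Proof. by move=> hP; apply: outcome_step1 hP => //=; rewrite tape_bits_string. Qed.

(** [d] ones remain before the separating 0. At that 0 the input cell is blank exactly when
    [n <= i]; two further steps read the 0 and the first bit of [x]. *)
Lemma outcome_check i x k d : (k + d = i)%N ->
  out (at_head Check (nseq i true ++ false :: x) (Posz k)) d.+2
    ((n <= i)%N /\ head false x = b0).
Proof.
elim: d k => [|d IHd] k kd.
  rewrite addn0 in kd; rewrite -kd.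
  have e : string_tape (nseq k true ++ false :: x) (Posz k) = Some false.
    rewrite string_tapeE (nth_map false) ?size_cat ?size_nseq ?addnS ?ltnS ?leq_addr //.
    by rewrite nth_cat size_nseq ltnn subnn.
  case: (leqP n k) => nk.
    have e' : string_tape w (Posz k) = None by rewrite string_tapeE nth_default ?size_map.
    apply: (@outcome_step1 _ _ _ (at_head Final (nseq k true ++ false :: x) (Posz k.+1))) => //.
      by rewrite (@search_step_keep _ Final _ _ true) ?right_of // e e'.
    (* For empty [x] the cell is blank, and the default [false] agrees with [head false x]. *)
    have e2 : odflt false (string_tape (nseq k true ++ false :: x) (Posz k.+1)) = head false x.
      rewrite string_tapeE map_cat nth_cat size_map size_nseq ltnNge leqnSn /= subSnn /=.
      by case: (x).
    apply: (@outcome_step1 _ _ _ (at_head (if head false x == b0 then Accept else Reject)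
        (nseq k true ++ false :: x) (Posz k.+2))) => //.
      by rewrite -(right_of k.+1) -e2; apply: (@search_step_keep Final).
    case: eqP => hx; first by apply: (@outcome_iff _ _ _ _ True); [split|apply: outcome_acc].
    by apply: (@outcome_iff _ _ _ _ False); [split=> // -[]|apply: outcome_rej].
  have e' : string_tape w (Posz k) = Some (nth false w k) by rewrite string_tapeE (nth_map false).
  apply: (@outcome_step1 _ _ _ (at_head Reject (nseq k true ++ false :: x) (Posz k.+1))) => //.
    by rewrite (@search_step_keep _ Reject _ _ true) ?right_of // e e'.
  by apply: (@outcome_iff _ _ _ _ False); [split=> // -[]|apply: outcome_rej].
have ki : (k < i)%N by rewrite -kd addnS ltnS leq_addr.
have e : string_tape (nseq i true ++ false :: x) (Posz k) = Some true.
  rewrite string_tapeE (nth_map false) ?size_cat ?size_nseq ?(leq_trans ki) ?leq_addr //.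
  by rewrite nth_cat size_nseq ki nth_nseq ki.
apply: outcome_step1 (IHd k.+1 _) => //; last by rewrite addSnnS.
rewrite (@search_step_keep _ Check _ _ true) ?right_of // e.
by case: (string_tape w _).
Qed.

Lemma bool_oracle_pair i x : O (nseq i true ++ false :: x) = nth false (A x) i.
Proof.
rewrite /bool_oracle /unpair.
have -> : find negb (nseq i true ++ false :: x) = i by elim: i => //= i ->.
rewrite size_cat size_nseq /= addnS ltnS leq_addr.
by rewrite -cat_rcons drop_size_cat // size_rcons size_nseq.
Qed.

(** Induction on the number [d] of unverified bits of [A x]. A round of query, shift and return fits
    into [4 * n + 6] steps; [n + 4] pays for the last query and the check. *)
Lemma outcome_verify x d i : size x = n -> size (A x) = n -> (i + d = n)%N ->
  out (at_head Query (nseq i true ++ false :: x) (Posz 0)) (n + 4 + d * (4 * n + 6))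
    (drop i (A x) = nseq d true /\ head false x = b0).
Proof.
move=> sx sA; elim: d i => [|d IHd] i id.
  rewrite addn0 in id; rewrite mul0n addn0 addnS id; apply: outcome_query => //.
  (* A query beyond the length of [A x] is answered [false], which sends the machine to [Check] with
     the 0 just past the input. *)
  rewrite bool_oracle_pair nth_default ?sA //.
  apply: (@outcome_mono _ _ _ n.+2); first lia.
  apply: outcome_iff (outcome_check x (add0n n)).
  by rewrite drop_oversize ?sA // leqnn; split=> -[].
have iA : (i < size (A x))%N by rewrite sA; lia.
rewrite mulSn addnA; set B := (n + 4 + _)%N.
case Ei: (nth false (A x) i); last first.
  apply: (@outcome_mono _ _ _ (i.+2).+1); first by rewrite /B; lia.
  apply: outcome_query; rewrite bool_oracle_pair Ei.
  apply: outcome_iff (outcome_check x (add0n i)).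
  rewrite (drop_nth false iA) Ei; split=> [[]|[]] //; lia.
have := IHd i.+1; rewrite addSnnS => /(_ id) IH.
apply: (@outcome_mono _ _ _ (n + 4 + d * (4 * n + 6) + (n + i).+2 + (n + i).+2).+1).
  by rewrite /B; lia.
apply: outcome_query; rewrite bool_oracle_pair Ei.
have sz : (size (nseq i true ++ false :: x)).+1 = (n + i).+2.
  by rewrite size_cat size_nseq /= sx; lia.
rewrite -sz; apply: outcome_insert_round; apply: outcome_iff IH.
by rewrite (drop_nth false iA) Ei; split=> [[-> ->]|[[-> ->]]].
Qed.

Hypothesis sizeA : forall x, size (A x) = size x.

(** Induction on the number [d] of bits still to be guessed; the two successors correspond to the
    first bit of the completion [v]. *)
Lemma outcome_guess d u : (size u + d = n)%N ->
  out (at_head Guess u (Posz (size u))) (10 + 9 * n + n * (4 * n + 6) + d)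
    (exists v, [/\ size v = d, A (u ++ v) = nseq n true & head false (u ++ v) = b0]).
Proof.
elim: d u => [|d IHd] u ud.
  rewrite addn0 in ud; have sA : size (A u) = n by rewrite sizeA.
  have := outcome_verify ud sA (add0n n); rewrite drop0 /= => hQ.
  apply: (@outcome_mono _ _ _ (n + 4 + n * (4 * n + 6) + n.+1 + n.+1 + n.+1).+1); first lia.
  apply: (@outcome_step1 _ _ _ (at_head Rewind u (left_of n))) => //.
    have e : string_tape w (Posz n) = None by rewrite string_tapeE nth_default ?size_map.
    by rewrite ud (@search_step_keep _ Rewind _ _ false) // e.
  apply: (@outcome_rewind Rewind (Insert false)) => //; first by rewrite ud.
  rewrite -ud; apply: outcome_insert_round; rewrite ud; apply: outcome_iff hQ.
  split=> [[h1 h2]|[v [sv h1 h2]]]; first by exists [::]; rewrite cats0.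
  by rewrite (size0nil sv) cats0 in h1 h2.
have un : (size u < n)%N by lia.
have h b : out (at_head Guess (rcons u b) (Posz (size u).+1)) (10 + 9 * n + n * (4 * n + 6) + d)
    (exists v, [/\ size v = d, A (rcons u b ++ v) = nseq n true & head false (rcons u b ++ v) = b0]).
  by rewrite -(size_rcons u b); apply: IHd; rewrite size_rcons addSnnS.
have e : string_tape w (Posz (size u)) = Some (nth false w (size u)).
  by rewrite string_tapeE (nth_map false).
rewrite addnS; apply: (@outcome_iff _ _ _ _ _ _ _ (outcome_step2 _ _ (h false) (h true))) => //.
  split=> [[[v [sv h1 h2]]|[v [sv h1 h2]]]|[[|b v] [] //= [sv] h1 h2]].
  - by exists (false :: v); rewrite /= sv -cat_rcons.
  - by exists (true :: v); rewrite /= sv -cat_rcons.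
  - by case: b h1 h2 => h1 h2; [right|left]; exists v; rewrite cat_rcons.
have step b : apply_move (at_head Guess u (Posz (size u)))
    (Guess, string_tape w (Posz (size u)), Some b, true, true) =
    at_head Guess (rcons u b) (Posz (size u).+1).
  have := apply_move_write Guess Guess u [::] b true; rewrite cats0 right_of => ->.
  by rewrite -cats1.
rewrite search_step // -!step e.
by rewrite -[LHS]/[:: apply_move _ _; apply_move _ _].
Qed.

End Search.

Lemma search_ntm_correct (b0 : bool) A : (forall x, size (A x) = size x) ->
  NP_rel A (fun y => exists x, size x = size y /\ A x = nseq (size y) true /\ head false x = b0).
Proof.
move=> sA; exists (search_ntm b0), 44%N => y.
have h := outcome_guess b0 sA (w := y) (u := [::]) (add0n (size y)).
(* The time is quadratic. For lengths 0 and 1 the additive 44 suffices; from 2 on,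
   [k ^ 44 >= k ^ 8 >= 64 * k ^ 2]. *)
have time : (10 + 9 * size y + size y * (4 * size y + 6) + size y <= size y ^ 44 + 44)%N.
  case: (size y) => [|[|m]] //; set k := m.+2.
  have k1 : (1 < k)%N by [].
  have : (k ^ 8 <= k ^ 44)%N by rewrite leq_exp2l.
  have -> : (k ^ 8 = k ^ 2 * k ^ 2 * k ^ 4)%N by rewrite -!expnD.
  have : (2 ^ 4 <= k ^ 4)%N by rewrite leq_exp2r.
  have : (2 ^ 2 <= k ^ 2)%N by rewrite leq_exp2r.
  rewrite (_ : 2 ^ 4 = 16)%N // (_ : 2 ^ 2 = 4)%N // (expnS k 1) expn1.
  move: (k ^ 4)%N (k ^ 44)%N => a b k4 a16 kb.
  have : (k * k * (4 * 16) <= k * k * (k * k) * a)%N.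
    by rewrite -[leqRHS]mulnA leq_mul // leq_mul.
  move: kb; set z := (_ * a)%N => zb hz; nia.
rewrite NatpowE; split; first by have [] := outcome_mono time h.
have [_ hP] := h; have {}hP : ntm_accepts (search_ntm b0) (bool_oracle A) y <-> _ := hP.
rewrite hP; split=> [[x [h1 [h2 h3]]]|[x [h1 h2 h3]]]; exists x => //.
Qed.

Theorem theorem3p6 (T : nat -> nat) :
  little_o_2pow_third T ->
  almost_surely_perm (fun A =>
    exists L : seq bool -> Prop, NP_coNP_rel A L /\ ~ BQTime_rel T A L).
Proof.
move=> oT e e0; have [B [K [pB [cB wB]]]] := BQTime_lang_null oT e0.
exists B, K; split; first exact: pB.
split; last exact: wB.
(* An exceptional oracle must let [lang A] be decided in the time bound, since otherwise [lang A]
   itself witnesses the separation. *)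
move=> A pA nA; apply: cB => //; apply: contrapT => nBQ; apply: nA.
exists (lang A); split=> //; have [sA [injA surA]] := pA.
split; first exact: (search_ntm_correct true sA).
have [M [d hM]] := search_ntm_correct false sA.
exists M, d => y; have [h1 h2] := hM y; split; first exact: h1.
(* A preimage of the ones exists by surjectivity and is unique by injectivity, so it starts with 0
   exactly when no preimage starts with 1. *)
rewrite -h2; split=> [nL|[x [sx [Ax hx]]] [x' [sx' [Ax' hx']]]].
  have [x [sx Ax]] := surA (nseq (size y) true); rewrite size_nseq in sx.
  exists x; do 2!split=> //; case hx: (head false x) => //.
  by case: nL; exists x.
have e' : x = x' by apply: injA; rewrite ?sx ?sx' ?Ax ?Ax'.
by rewrite e' hx' in hx.
Qed.
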